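(* Let $P$ be a full-dimensional convex polytope in $\mathbb{R}^d$. Then $$A_P(1) = \lim_{\epsilon\to0^+}\sum_{x\in\mathbb{Z}^d}(\mathbf{1}_P*\mathcal{G}_\epsilon)(x).$$
   Context: $\mathbf{1}_P$ is the indicator function of $P$; $\mathcal{G}_\epsilon(x) := \epsilon^{-d/2}e^{-\pi\|x\|^2/\epsilon}$; $\omega_P(x) := \lim_{r\to0^+}\frac{\mathrm{vol}(B(x,r)\cap P)}{\mathrm{vol}(B(x,r))}$; $A_P(t):=\sum_{x\in\mathbb{Z}^d}\omega_{tP}(x)$, so $A_P(1)=\sum_{x\in\mathbb{Z}^d}\omega_P(x)$. *)

(* Defs.v *)
From Stdlib Require Import Reals Lra Lia ZArith List ClassicalEpsilon.
Import ListNotations.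
Open Scope R_scope.

(* Points of R^d are functions nat -> R; only coordinates i < d matter.
   Lattice points of Z^d are functions nat -> Z (coordinates >= d are 0). *)
Definition vec := nat -> R.
Definition zvec := nat -> Z.

Fixpoint sum_lt (d : nat) (f : nat -> R) : R :=
  match d with O => 0 | S d' => sum_lt d' f + f d' end.

Definition dot (d : nat) (a x : vec) : R := sum_lt d (fun i => a i * x i).
Definition norm2 (d : nat) (x : vec) : R := sum_lt d (fun i => x i * x i).
Definition vsub (x y : vec) : vec := fun i => x i - y i.
Definition ofZ (k : zvec) : vec := fun i => IZR (k i).

Definition in_poly (d : nat) (H : list (vec * R)) (x : vec) : Prop :=
  Forall (fun h => dot d (fst h) x <= snd h) H.

Definition in_ball (d : nat) (c : vec) (r : R) (x : vec) : Prop :=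
  norm2 d (vsub x c) < r * r.

Definition full_dim_polytope (d : nat) (H : list (vec * R)) : Prop :=
  (exists M : R, forall x, in_poly d H x -> forall i, (i < d)%nat -> Rabs (x i) <= M) /\
  (exists (x0 : vec) (r0 : R), 0 < r0 /\ forall x, in_ball d x0 r0 x -> in_poly d H x).

Definition indic (A : vec -> Prop) (x : vec) : R :=
  if excluded_middle_informative (A x) then 1 else 0.

Definition zrange (N : nat) : list Z :=
  map (fun j => (Z.of_nat j - Z.of_nat N)%Z) (seq 0 (2 * N + 1)).

Fixpoint box (d N : nat) : list zvec :=
  match d with
  | O => [fun _ => 0%Z]
  | S d' => flat_map (fun v => map (fun k => fun i => if Nat.eqb i d' then k else v i)
                                   (zrange N)) (box d' N)
  end.

Definition lsum {A : Type} (f : A -> R) (l : list A) : R :=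
  fold_right (fun a acc => f a + acc) 0 l.

Definition is_lattice_sum (d : nat) (g : zvec -> R) (S : R) : Prop :=
  Un_cv (fun N => lsum g (box d N)) S.

(* Integral over R^d of a bounded-support function, as the limit of Riemann sums
   on the grids (1/(n+1)) Z^d (this is the Riemann integral for the Riemann-
   integrable functions used here). *)
Definition grid_pt (k : zvec) (n : nat) : vec := fun i => IZR (k i) / INR (S n).

Definition is_integral (d : nat) (f : vec -> R) (I : R) : Prop :=
  exists M : nat,
    (forall y, f y <> 0 -> forall i, (i < d)%nat -> Rabs (y i) <= INR M) /\
    Un_cv (fun n => lsum (fun k => f (grid_pt k n)) (box d (M * S n)) / INR (S n) ^ d) I.

Definition is_solid_angle (d : nat) (H : list (vec * R)) (x : vec) (w : R) : Prop :=
  forall e, 0 < e -> exists delta, 0 < delta /\ forall r, 0 < r < delta ->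
    exists vB vBP,
      is_integral d (indic (in_ball d x r)) vB /\
      is_integral d (indic (fun y => in_ball d x r y /\ in_poly d H y)) vBP /\
      Rabs (vBP / vB - w) < e.

Definition gauss (d : nat) (eps : R) (z : vec) : R :=
  Rpower eps (- INR d / 2) * exp (- PI * norm2 d z / eps).

(* Main.v *)
(** For [x] in [Z^d] the polytope [P] agrees with a cone with apex [x] near [x], so
    [vol (B(x,r) ∩ P) / vol (B(x,r))] does not depend on [r] for small [r]: it is the solid
    angle [w].  As the Gaussian centred at [x] is radial, its integral over
    [B(x,r) ∩ P] is [w] times its integral over [B(x,r)]; the latter tends to [1] and the
    part of [P] outside [B(x,r)] contributes exponentially little, so [1_P * G_eps] tends to
    [w] at [x].  Lattice points outside a fixed box containing [P] contribute at most
    [C * eps * prod_i exp (- excess (x_i))], which is summable with a sum of order [eps].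

    Integrals are limits of Riemann sums over the grids [s Z^d + v], uniformly in [v]: this
    makes translation and dilation invariance immediate.  Compactly supported Lipschitz
    functions are integrable, and indicators of star-shaped bodies with a Lipschitz gauge
    are squeezed between a Lipschitz cutoff and its dilate. *)

From Coquelicot Require Import Coquelicot.
Require Import Defs.
From Stdlib Require Import Reals ZArith List.
From Stdlib Require Import Lra Lia ClassicalEpsilon FunctionalExtensionality.
Import ListNotations.
Open Scope R_scope.

(** * Finite sums over boxes of lattice points *)

(** With integrals taken as limits of Riemann sums, dominated convergence and polar coordinates are
    replaced by explicit inequalities. Existence of an integral comes from Lipschitz cutoffs; a
    product of one-variable functions is the only multiple integral whose value is computed, and it
    suffices for the mass of the Gaussian. That the Gaussian weighs the cone in the proportion [w]
    is proved by letting the radius grow: both integrals over the ball increase by nearly constant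
    multiples of the same volume increment, and the errors add up to nothing as the shells get
    thinner. Dividing by the volume of a ball requires it to be positive; this is read off from the
    Gaussian mass, since the Gaussian profile is at most 1. The solid angle and the limit of the
    convolution are produced together from one dilation argument, so they are the same [w]. The
    vanishing of solid angles far from [P] needs no geometry: the tail bound forces the limit to be
    0 there, and [A] is a finite sum. *)

Section Sums.
Context {A B : Type}.
Implicit Types (f g : A -> R) (l : list A).

Lemma lsum_app f l l' : lsum f (l ++ l') = lsum f l + lsum f l'.
Proof. induction l as [|a l IH]; simpl; [|rewrite IH]; lra. Qed.

Lemma lsum_map (h : B -> A) f (l : list B) :
  lsum f (map h l) = lsum (fun b => f (h b)) l.
Proof. induction l as [|a l IH]; simpl; [|rewrite IH]; lra. Qed.

Lemma lsum_flat_map (h : B -> list A) f (l : list B) :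
  lsum f (flat_map h l) = lsum (fun b => lsum f (h b)) l.
Proof. induction l as [|a l IH]; simpl; [|rewrite lsum_app, IH]; lra. Qed.

Lemma lsum_ext_in f g l : (forall a, In a l -> f a = g a) -> lsum f l = lsum g l.
Proof.
  induction l as [|a l IH]; simpl; intros E; [reflexivity|].
  rewrite E, IH; auto.
Qed.

Lemma lsum_ext f g l : (forall a, f a = g a) -> lsum f l = lsum g l.
Proof. intros E; apply lsum_ext_in; auto. Qed.

Lemma lsum_le f g l : (forall a, f a <= g a) -> lsum f l <= lsum g l.
Proof.
  intros E; induction l as [|a l IH]; simpl; [lra|].
  specialize (E a); lra.
Qed.

Lemma lsum_minus f g l : lsum (fun a => f a - g a) l = lsum f l - lsum g l.
Proof. induction l as [|a l IH]; simpl; [|rewrite IH]; lra. Qed.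

Lemma lsum_plus f g l : lsum (fun a => f a + g a) l = lsum f l + lsum g l.
Proof. induction l as [|a l IH]; simpl; [|rewrite IH]; lra. Qed.

Lemma lsum_scal c f l : lsum (fun a => c * f a) l = c * lsum f l.
Proof. induction l as [|a l IH]; simpl; [|rewrite IH]; lra. Qed.

Lemma lsum_zero l : lsum (fun _ => 0) l = 0.
Proof. induction l as [|a l IH]; simpl; [|rewrite IH]; lra. Qed.

Lemma lsum_nonneg f l : (forall a, 0 <= f a) -> 0 <= lsum f l.
Proof. intros E; rewrite <- (lsum_zero l); apply lsum_le, E. Qed.

Lemma lsum_abs f l : Rabs (lsum f l) <= lsum (fun a => Rabs (f a)) l.
Proof.
  induction l as [|a l IH]; simpl; [rewrite Rabs_R0; lra|].
  eapply Rle_trans; [apply Rabs_triang|lra].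
Qed.
End Sums.

Lemma lsum_telescope (G : nat -> R) a n :
  lsum (fun j => G (S j) - G j) (seq a n) = G (a + n)%nat - G a.
Proof.
  revert a; induction n as [|n IH]; intros a; simpl.
  - rewrite Nat.add_0_r; lra.
  - rewrite IH, Nat.add_succ_r; simpl; lra.
Qed.

(** Serves twice for rows of a grid: to bound them by a total length, and to add up integrals over
    consecutive cells. *)
Lemma lsum_zrange_telescope (G : Z -> R) N :
  lsum (fun j => G (j + 1)%Z - G j) (zrange N) = G (Z.of_nat N + 1)%Z - G (- Z.of_nat N)%Z.
Proof.
  unfold zrange; rewrite lsum_map.
  rewrite (lsum_ext _ (fun j => (fun j => G (Z.of_nat j - Z.of_nat N)%Z) (S j)
                               - (fun j => G (Z.of_nat j - Z.of_nat N)%Z) j)).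
  - rewrite (lsum_telescope (fun j => G (Z.of_nat j - Z.of_nat N)%Z)).
    cbv beta; do 2 f_equal; lia.
  - intros j; cbv beta.
    now replace (Z.of_nat (S j) - Z.of_nat N)%Z with (Z.of_nat j - Z.of_nat N + 1)%Z by lia.
Qed.

Lemma zrange_S N :
  zrange (S N) = (- Z.of_nat (S N))%Z :: zrange N ++ [Z.of_nat (S N)].
Proof.
  unfold zrange.
  replace (2 * S N + 1)%nat with (S (2 * N + 1 + 1)) by lia.
  rewrite <- cons_seq, (seq_app (2 * N + 1) 1), map_cons, map_app, <- seq_shift, map_map.
  f_equal; f_equal.
  - apply map_ext; intros. lia.
  - cbn [seq map]; f_equal; lia.
Qed.

Lemma lsum_zrange_S (f : Z -> R) N :
  lsum f (zrange (S N)) =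
  f (- Z.of_nat (S N))%Z + lsum f (zrange N) + f (Z.of_nat (S N)).
Proof. rewrite zrange_S; simpl; rewrite lsum_app; simpl; ring. Qed.

Lemma lsum_box_S d N (F : zvec -> R) :
  lsum F (box (S d) N) =
  lsum (fun v => lsum (fun k => F (fun i => if Nat.eqb i d then k else v i)) (zrange N))
       (box d N).
Proof.
  simpl; rewrite lsum_flat_map; apply lsum_ext; intros v; now rewrite lsum_map.
Qed.

Lemma lsum_zrange_stable (f : Z -> R) K N :
  (K <= N)%nat -> (forall k, f k <> 0 -> (Z.abs k <= Z.of_nat K)%Z) ->
  lsum f (zrange N) = lsum f (zrange K).
Proof.
  intros HKN Hf; induction HKN as [|N HKN IH]; [reflexivity|].
  assert (E : forall k, (Z.of_nat K < Z.abs k)%Z -> f k = 0).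
  { intros k Hk; destruct (Req_dec (f k) 0) as [|Hn]; [assumption|].
    specialize (Hf k Hn); lia. }
  rewrite lsum_zrange_S, IH, !E by lia; lra.
Qed.

Lemma lsum_box_stable d K N (F : zvec -> R) :
  (K <= N)%nat ->
  (forall k, F k <> 0 -> forall i, (i < d)%nat -> (Z.abs (k i) <= Z.of_nat K)%Z) ->
  lsum F (box d N) = lsum F (box d K).
Proof.
  intros HKN; revert F; induction d as [|d IH]; intros F HF; [reflexivity|].
  rewrite !lsum_box_S, <- (IH _).
  - apply lsum_ext; intros v; apply lsum_zrange_stable; [assumption|].
    intros k Hk; specialize (HF _ Hk d ltac:(lia)); simpl in HF.
    now rewrite Nat.eqb_refl in HF.
  - intros v Hv i Hi.
    destruct (Z.leb_spec (Z.abs (v i)) (Z.of_nat K)) as [|Hlt]; [assumption|].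
    exfalso; apply Hv; rewrite <- (lsum_zero (zrange K)); apply lsum_ext; intros k.
    destruct (Req_dec (F (fun j => if Nat.eqb j d then k else v j)) 0) as [|Hn];
      [assumption|].
    specialize (HF _ Hn i ltac:(lia)); simpl in HF.
    destruct (Nat.eqb_spec i d); lia.
Qed.

Lemma lsum_zrange_mono (f : Z -> R) N :
  (forall k, 0 <= f k) -> lsum f (zrange N) <= lsum f (zrange (S N)).
Proof.
  intros Hf; rewrite lsum_zrange_S.
  pose proof (Hf (- Z.of_nat (S N))%Z); pose proof (Hf (Z.of_nat (S N))); lra.
Qed.

Lemma lsum_box_mono d N (F : zvec -> R) :
  (forall k, 0 <= F k) -> lsum F (box d N) <= lsum F (box d (S N)).
Proof.
  revert F; induction d as [|d IH]; intros F HF; [simpl; lra|].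
  rewrite !lsum_box_S.
  eapply Rle_trans; [apply IH|].
  - intros v; apply lsum_nonneg; auto.
  - apply lsum_le; intros v; apply lsum_zrange_mono; auto.
Qed.

Fixpoint prod_lt (d : nat) (u : nat -> R) : R :=
  match d with O => 1 | S d' => prod_lt d' u * u d' end.

Lemma prod_lt_ext d u v : (forall i, (i < d)%nat -> u i = v i) -> prod_lt d u = prod_lt d v.
Proof.
  induction d as [|d IH]; simpl; intros E; [reflexivity|].
  rewrite IH, E; auto.
Qed.

Lemma sum_lt_ext d u v : (forall i, (i < d)%nat -> u i = v i) -> sum_lt d u = sum_lt d v.
Proof.
  induction d as [|d IH]; simpl; intros E; [reflexivity|].
  rewrite IH, E; auto.
Qed.

Lemma lsum_box_prod d N (w : Z -> R) :
  lsum (fun k => prod_lt d (fun i => w (k i))) (box d N) = lsum w (zrange N) ^ d.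
Proof.
  induction d as [|d IH]; [simpl; lra|].
  rewrite lsum_box_S; simpl pow; rewrite <- IH, <- lsum_scal.
  apply lsum_ext; intros v; cbn [prod_lt]; rewrite Nat.eqb_refl.
  rewrite Rmult_comm, <- lsum_scal; apply lsum_ext; intros k.
  f_equal; apply prod_lt_ext; intros i Hi.
  destruct (Nat.eqb_spec i d); [lia|reflexivity].
Qed.

(** * Riemann sums on shifted grids, and the integral they define *)

Definition upd (x : vec) (i : nat) (t : R) : vec := fun j => if Nat.eqb j i then t else x j.

(** The index box is centred at 0 whatever the shift, so a support of radius [M] is sure to be
    covered only once [s * INR N] exceeds [M] plus the size of [v]. *)
Definition riemann_sum (d N : nat) (s : R) (v : vec) (f : vec -> R) : R :=
  lsum (fun k => f (fun i => s * IZR (k i) + v i)) (box d N) * s ^ d.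

(** Discrete Fubini: summing the last coordinate first reduces induction on the dimension to
    one-variable row sums. *)
Lemma riemann_sum_S d N s v f :
  riemann_sum (S d) N s v f =
  riemann_sum d N s v
    (fun x => s * lsum (fun j => f (upd x d (s * IZR j + v d))) (zrange N)).
Proof.
  unfold riemann_sum; rewrite lsum_box_S, lsum_scal; simpl pow.
  rewrite (lsum_ext _ (fun k => lsum (fun j =>
    f (upd (fun i => s * IZR (k i) + v i) d (s * IZR j + v d))) (zrange N))); [ring|].
  intros k; apply lsum_ext; intros j; f_equal; unfold upd.
  apply functional_extensionality; intros i.
  destruct (Nat.eqb_spec i d); subst; reflexivity.
Qed.

(* Uniformity in the shift [v] is what makes the integral translation invariant. *)
Definition grid (P : R * vec * nat -> Prop) : Prop :=
  exists delta, 0 < delta /\ forall s v, 0 < s < delta ->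
    exists N0, forall N, (N0 <= N)%nat -> P (s, v, N).

Global Instance grid_proper : ProperFilter grid.
Proof.
  split.
  - intros P (de & Hde & HP).
    destruct (HP (de / 2) (fun _ => 0) ltac:(lra)) as (N0 & H); eauto.
  - split.
    + exists 1; split; [lra|]; intros; now exists 0%nat.
    + intros P Q (d1 & H1 & HP) (d2 & H2 & HQ).
      exists (Rmin d1 d2); split; [apply Rmin_glb_lt; assumption|].
      intros s v Hs.
      pose proof (Rmin_l d1 d2); pose proof (Rmin_r d1 d2).
      destruct (HP s v ltac:(lra)) as (N1 & K1); destruct (HQ s v ltac:(lra)) as (N2 & K2).
      exists (Nat.max N1 N2); intros N HN; split; [apply K1|apply K2]; lia.
    + intros P Q HPQ (d1 & H1 & HP); exists d1; split; [assumption|].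
      intros s v Hs; destruct (HP s v Hs) as (N1 & K1); exists N1; auto.
Qed.

Definition gsum d f (t : R * vec * nat) : R := riemann_sum d (snd t) (fst (fst t)) (snd (fst t)) f.

(** For functions of bounded support this is stronger than [is_integral], which looks only at the
    steps [/ INR (S n)] and the shift 0. *)
Definition has_int (d : nat) (f : vec -> R) (I : R) : Prop :=
  filterlim (gsum d f) grid (locally I).

Lemma grid_step_pos : grid (fun t => 0 < fst (fst t)).
Proof. exists 1; split; [lra|]; intros s v Hs; exists 0%nat; simpl; intros; lra. Qed.

Section Integral.
Variable d : nat.
Implicit Types f g h : vec -> R.

Lemma has_int_ext f g a : (forall x, f x = g x) -> has_int d f a -> has_int d g a.
Proof.
  intros E H; replace g with f; [assumption|].
  apply functional_extensionality, E.
Qed.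

Lemma has_int_unique f a b : has_int d f a -> has_int d f b -> a = b.
Proof. intros H1 H2; exact (filterlim_locally_unique (V := R_NormedModule) _ _ _ H1 H2). Qed.

Lemma gsum_le f g : (forall x, f x <= g x) -> grid (fun t => gsum d f t <= gsum d g t).
Proof.
  intros Hfg; apply filter_imp with (2 := grid_step_pos); intros [[s v] N] Hs; simpl in Hs.
  apply Rmult_le_compat_r; [apply pow_le, Rlt_le, Hs|].
  apply lsum_le; intros k; apply Hfg.
Qed.

Lemma has_int_le f g a b :
  (forall x, f x <= g x) -> has_int d f a -> has_int d g b -> a <= b.
Proof.
  intros Hfg Hf Hg.
  exact (filterlim_le (gsum d f) (gsum d g) (Finite a) (Finite b) (gsum_le f g Hfg) Hf Hg).
Qed.

Lemma has_int_zero : has_int d (fun _ => 0) 0.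
Proof.
  apply (filterlim_ext (fun _ => 0)); [|apply filterlim_const].
  intros [[s v] N]; unfold gsum, riemann_sum; simpl; rewrite lsum_zero; ring.
Qed.

Lemma has_int_nonneg f a : (forall x, 0 <= f x) -> has_int d f a -> 0 <= a.
Proof. intros Hf H; exact (has_int_le _ _ _ _ Hf has_int_zero H). Qed.

Lemma has_int_scal c f a : has_int d f a -> has_int d (fun x => c * f x) (c * a).
Proof.
  intros H.
  apply (filterlim_ext (fun t => scal c (gsum d f t))).
  - intros [[s v] N]; unfold gsum, riemann_sum; simpl; rewrite lsum_scal.
    unfold scal; simpl; unfold mult; simpl; ring.
  - eapply filterlim_comp; [exact H|]; apply (filterlim_scal_r (V := R_NormedModule)).
Qed.

Lemma has_int_plus f g a b :
  has_int d f a -> has_int d g b -> has_int d (fun x => f x + g x) (a + b).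
Proof.
  intros H1 H2.
  apply (filterlim_ext (fun t => plus (gsum d f t) (gsum d g t))).
  - intros [[s v] N]; unfold gsum, riemann_sum; simpl; rewrite lsum_plus.
    unfold plus; simpl; ring.
  - eapply filterlim_comp_2; [exact H1|exact H2|].
    apply (filterlim_plus (V := R_NormedModule)).
Qed.

Lemma has_int_minus f g a b :
  has_int d f a -> has_int d g b -> has_int d (fun x => f x - g x) (a - b).
Proof.
  intros H1 H2; apply (has_int_ext (fun x => f x + (-1) * g x)); [intros; lra|].
  replace (a - b) with (a + (-1) * b) by ring.
  apply has_int_plus, has_int_scal; assumption.
Qed.

(** No candidate for [I] is given, so it comes from completeness of the reals: two fine sums both
    lie between [a - e / 4] and [b + e / 4], an interval of length at most [e] when
    [b - a <= e / 2]. *)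
Lemma has_int_squeeze f :
  (forall e, 0 < e -> exists g h a b,
     (forall x, g x <= f x <= h x) /\ has_int d g a /\ has_int d h b /\ b - a <= e) ->
  exists I, has_int d f I.
Proof.
  intros H; apply (filterlim_locally_cauchy (U := R_CompleteSpace)); intros e.
  destruct (H (e / 2)) as (g & h & a & b & Hfg & Hg & Hh & Hab);
    [pose proof (cond_pos e); lra|].
  exists (fun t => a - e / 4 < gsum d f t < b + e / 4).
  pose proof (cond_pos e) as He.
  split.
  - assert (He4 : 0 < e / 4) by lra.
    pose proof (proj1 (filterlim_locally _ _) Hg (mkposreal _ He4)) as Kg.
    pose proof (proj1 (filterlim_locally _ _) Hh (mkposreal _ He4)) as Kh.
    pose proof (filter_and _ _ (filter_and _ _ Kg Kh)
      (filter_and _ _ (gsum_le g f (fun x => proj1 (Hfg x)))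
                      (gsum_le f h (fun x => proj2 (Hfg x))))) as K.
    apply filter_imp with (2 := K); intros t [[K1 K2] [K3 K4]].
    apply Rabs_def2 in K1; apply Rabs_def2 in K2.
    unfold minus, plus, opp in K1, K2; simpl in K1, K2; lra.
  - intros u v Hu Hv; apply Rabs_def1; unfold minus, plus, opp; simpl; lra.
Qed.

(** A Riemann sum of the composed function with step [s] and shift [v] is exactly the sum of [f]
    with step [l * s] and shift [l * v + w], divided by [l ^ d]. The threshold on the step does not
    depend on the shift, so the limit is the same. *)
Lemma has_int_affine l w f a :
  0 < l -> has_int d f a -> has_int d (fun x => f (fun i => l * x i + w i)) (a / l ^ d).
Proof.
  intros Hl Hf.
  assert (Hld : 0 < l ^ d) by now apply pow_lt.
  apply (filterlim_ext (fun t => scal (/ l ^ d)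
    (gsum d f (l * fst (fst t), (fun i => l * snd (fst t) i + w i), snd t)))).
  - intros [[s v] N]; unfold gsum, riemann_sum; simpl.
    unfold scal; simpl; unfold mult; simpl.
    rewrite Rpow_mult_distr.
    rewrite (lsum_ext _ (fun k => f (fun i => l * (s * IZR (k i) + v i) + w i))).
    + field; lra.
    + intros k; f_equal; apply functional_extensionality; intros; ring.
  - unfold Rdiv; rewrite Rmult_comm.
    eapply filterlim_comp; [|apply (filterlim_scal_r (V := R_NormedModule))].
    eapply filterlim_comp; [|exact Hf].
    intros P (de & Hde & HP); exists (de / l); split; [now apply Rdiv_lt_0_compat|].
    intros s v [Hs1 Hs2]; simpl.
    apply (HP (l * s) (fun i => l * v i + w i)); split; [now apply Rmult_lt_0_compat|].
    apply (Rmult_lt_compat_l l) in Hs2; [|assumption].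
    replace (l * (de / l)) with de in Hs2 by (field; lra); assumption.
Qed.
End Integral.

Lemma has_int_is_integral d f I M :
  (forall x, f x <> 0 -> forall i, (i < d)%nat -> Rabs (x i) <= INR M) ->
  has_int d f I -> is_integral d f I.
Proof.
  intros Hs Hf; exists M; split; [assumption|]; intros e He.
  destruct (proj1 (filterlim_locally _ _) Hf (mkposreal _ He)) as (de & Hde & HP).
  destruct (archimed_cor1 de Hde) as (n0 & Hn0 & Hpos).
  exists n0; intros n Hn.
  assert (HSn : 0 < INR (S n)) by apply lt_0_INR, Nat.lt_0_succ.
  assert (Hlt : 0 < / INR (S n) < de).
  { split; [now apply Rinv_0_lt_compat|].
    apply Rle_lt_trans with (/ INR n0); [|assumption].
    apply Rinv_le_contravar; [apply lt_0_INR; lia|apply le_INR; lia]. }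
  destruct (HP _ (fun _ => 0) Hlt) as (N0 & HN).
  specialize (HN (Nat.max N0 (M * S n)) ltac:(lia)).
  unfold gsum, riemann_sum in HN; cbn [fst snd] in HN.
  rewrite (lsum_ext _ (fun k => f (grid_pt k n))) in HN.
  2:{ intros k; f_equal; apply functional_extensionality; intros i.
      unfold grid_pt, Rdiv; ring. }
  (* A grid point in the support has [|k i| <= M * S n], so the large box of the filter and the box
     prescribed by [is_integral] give the same sum. *)
  rewrite (lsum_box_stable d (M * S n)) in HN; [|lia|].
  - unfold R_dist; rewrite pow_inv in HN; exact HN.
  - intros k Hk i Hi; specialize (Hs _ Hk i Hi); unfold grid_pt in Hs.
    apply le_IZR; rewrite abs_IZR, <- INR_IZR_INZ, mult_INR.
    rewrite Rabs_div, (Rabs_pos_eq (INR (S n))) in Hs by lra.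
    apply (Rmult_le_compat_r (INR (S n))) in Hs; [|lra].
    replace (Rabs (IZR (k i)) / INR (S n) * INR (S n)) with (Rabs (IZR (k i))) in Hs
      by (field; lra).
    exact Hs.
Qed.

(** * Lipschitz functions *)

Definition row_sum (s v : R) (N : nat) (phi : R -> R) : R :=
  s * lsum (fun j => phi (s * IZR j + v)) (zrange N).

(* The steps of the truncation of [s j + v] to [-M, M + s] add up to at most
   [2 M + s], and such a step has full length [s] whenever [|s j + v| <= M]. *)
Lemma row_sum_bound (phi : R -> R) M s v N B :
  0 <= M -> 0 < s -> 0 <= B -> (forall t, Rabs (phi t) <= B) -> (forall t, phi t <> 0 -> Rabs t <= M) ->
  Rabs (row_sum s v N phi) <= B * (2 * M + s).
Proof.
  intros M_ge0 s_gt0 HB Hb Hs.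
  set (c := fun j : Z => B * Rmax (- M) (Rmin (M + s) (s * IZR j + v))).
  assert (Hc : lsum (fun j => c (j + 1)%Z - c j) (zrange N) <= B * (2 * M + s)).
  { rewrite lsum_zrange_telescope; unfold c; rewrite <- Rmult_minus_distr_l.
    apply Rmult_le_compat_l; [assumption|].
    unfold Rmax, Rmin; repeat destruct Rle_dec; lra. }
  eapply Rle_trans; [|exact Hc].
  unfold row_sum; rewrite Rabs_mult, (Rabs_pos_eq s) by lra.
  eapply Rle_trans; [apply Rmult_le_compat_l; [lra|apply lsum_abs]|].
  rewrite <- lsum_scal; apply lsum_le; intros j; unfold c.
  rewrite plus_IZR; replace (s * (IZR j + 1) + v) with (s * IZR j + v + s) by ring.
  set (t := s * IZR j + v).
  rewrite <- Rmult_minus_distr_l.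
  destruct (Req_dec (phi t) 0) as [E|E].
  - rewrite E, Rabs_R0, Rmult_0_r; apply Rmult_le_pos; [assumption|].
    unfold Rmax, Rmin; repeat destruct Rle_dec; lra.
  - apply Hs, Rabs_le_between in E.
    replace (Rmax (- M) (Rmin (M + s) (t + s)) - Rmax (- M) (Rmin (M + s) t)) with s
      by (unfold Rmax, Rmin; repeat destruct Rle_dec; lra).
    rewrite Rmult_comm; apply Rmult_le_compat_r; [lra|apply Hb].
Qed.

Section OneVariable.
Variables (phi : R -> R) (L M s v : R) (N : nat).
Hypotheses (M_ge0 : 0 <= M) (s_gt0 : 0 < s).
Hypotheses (L_ge0 : 0 <= L)
  (phi_lip : forall x y, Rabs (phi x - phi y) <= L * Rabs (x - y)).

Lemma lipschitz_continuous x : continuous phi x.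
Proof using L_ge0 phi_lip.
  apply (filterlim_locally (U := R_UniformSpace)); intros e.
  assert (Hd : 0 < e / (L + 1)) by (apply Rdiv_lt_0_compat; [apply cond_pos|lra]).
  exists (mkposreal _ Hd); intros y Hy.
  change (Rabs (y - x) < e / (L + 1)) in Hy; change (Rabs (phi y - phi x) < e).
  eapply Rle_lt_trans; [apply phi_lip|].
  apply (Rmult_lt_compat_l (L + 1)) in Hy; [|lra].
  replace ((L + 1) * (e / (L + 1))) with (pos e) in Hy by (field; lra).
  pose proof (Rabs_pos (y - x)); lra.
Qed.

Lemma lipschitz_ex_RInt a b : ex_RInt phi a b.
Proof using L_ge0 phi_lip.
  apply (ex_RInt_continuous (V := R_CompleteNormedModule)).
  intros; apply lipschitz_continuous.
Qed.

Hypothesis phi_supp : forall t, phi t <> 0 -> Rabs t <= M.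

Lemma phi_outside t : M < Rabs t -> phi t = 0.
Proof using phi_supp.
  intros Ht; destruct (Req_dec (phi t) 0) as [|E]; [assumption|].
  apply phi_supp in E; lra.
Qed.

Lemma RInt_outside a b :
  (forall t, Rmin a b < t < Rmax a b -> M < Rabs t) -> RInt phi a b = 0.
Proof using phi_supp.
  intros H; rewrite (RInt_ext _ (fun _ => 0)), RInt_const.
  - unfold scal; simpl; unfold mult; simpl; ring.
  - intros t Ht; apply phi_outside, H, Ht.
Qed.

(** The integral is itself a row sum, that of the cell averages of [phi]. The difference between
    [phi] and its cell average is at most [L * s] and is supported in [[-(M + s), M + s]], so
    [row_sum_bound] gives the stated constant. *)
Lemma row_sum_error :
  M + Rabs v <= s * INR N ->
  Rabs (row_sum s v N phi - RInt phi (- M) M) <= L * s * (2 * (M + s) + s).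
Proof using M_ge0 s_gt0 L_ge0 phi_lip phi_supp.
  intros HN.
  assert (Hv : - Rabs v <= v <= Rabs v) by (apply Rabs_le_between; lra).
  assert (HC : forall a b c, RInt phi a b + RInt phi b c = RInt phi a c).
  { intros a b c; exact (RInt_Chasles phi a b c (lipschitz_ex_RInt _ _)
      (lipschitz_ex_RInt _ _)). }
  assert (E : RInt phi (- M) M = row_sum s v N (fun t => / s * RInt phi t (t + s))).
  { unfold row_sum; rewrite <- lsum_scal.
    (* [P] is a primitive of [phi] sampled on the grid, so the cell integrals telescope. The
       condition on [N] puts both ends of the row outside [(-M, M)], where [phi] contributes
       nothing. *)
    set (P := fun j : Z => RInt phi 0 (s * IZR j + v)).
    rewrite (lsum_ext _ (fun j => P (j + 1)%Z - P j)).
    - rewrite lsum_zrange_telescope; unfold P.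
      rewrite plus_IZR, opp_IZR, <- INR_IZR_INZ.
      rewrite <- (HC 0 (s * - INR N + v) (s * (INR N + 1) + v)).
      rewrite <- (HC (s * - INR N + v) (- M) (s * (INR N + 1) + v)).
      rewrite <- (HC (- M) M (s * (INR N + 1) + v)).
      rewrite (RInt_outside (s * - INR N + v) (- M)), (RInt_outside M); [lra| |];
        intros t; rewrite Rmin_left, Rmax_right by nra; intros Ht.
      + rewrite Rabs_pos_eq; lra.
      + rewrite Rabs_left1; lra.
    - intros j; unfold P; rewrite plus_IZR.
      replace (s * (IZR j + 1) + v) with (s * IZR j + v + s) by ring.
      rewrite <- (HC 0 (s * IZR j + v) (s * IZR j + v + s)); field; lra. }
  replace (row_sum s v N phi - RInt phi (- M) M)
    with (row_sum s v N (fun t => phi t - / s * RInt phi t (t + s))).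
  2:{ rewrite E; unfold row_sum; rewrite lsum_minus; ring. }
  clear E.
  assert (Hsb : 0 <= L * s) by (apply Rmult_le_pos; lra).
  assert (Hpsi : forall t, Rabs (phi t - / s * RInt phi t (t + s)) <= L * s).
  { intros t.
    assert (HI : RInt (fun u => minus (phi t) (phi u)) t (t + s)
            = s * phi t - RInt phi t (t + s)).
    { rewrite (RInt_minus (V := R_CompleteNormedModule) (fun _ => phi t) phi), RInt_const.
      - unfold minus, plus, opp, scal; simpl; unfold mult; simpl; ring.
      - apply (ex_RInt_const (V := R_NormedModule)).
      - apply lipschitz_ex_RInt. }
    replace (phi t - / s * RInt phi t (t + s))
      with (/ s * RInt (fun u => minus (phi t) (phi u)) t (t + s))
      by (rewrite HI; field; lra).
    rewrite Rabs_mult, Rabs_pos_eq by now apply Rlt_le, Rinv_0_lt_compat.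
    apply Rmult_le_reg_l with s; [assumption|].
    rewrite <- Rmult_assoc, Rinv_r, Rmult_1_l by lra.
    replace s with (t + s - t) at 2 by ring.
    apply abs_RInt_le_const; [lra| |].
    - apply (ex_RInt_minus (V := R_NormedModule));
        [apply (ex_RInt_const (V := R_NormedModule))|apply lipschitz_ex_RInt].
    - intros u Hu; change (Rabs (phi t - phi u) <= L * s).
      eapply Rle_trans; [apply phi_lip|].
      apply Rmult_le_compat_l; [assumption|].
      rewrite Rabs_left1; lra. }
  clear HN Hv.
  set (psi := fun t => phi t - / s * RInt phi t (t + s)) in *.
  (* The average at [t] looks ahead by [s], which enlarges the support by at most [s]. *)
  assert (Hsupp : forall t, psi t <> 0 -> Rabs t <= M + s).
  { intros t Ht; destruct (Rle_lt_dec (Rabs t) (M + s)) as [|Hlt]; [assumption|].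
    exfalso; apply Ht; unfold psi; rewrite phi_outside by lra.
    rewrite RInt_outside; [ring|].
    rewrite Rmin_left, Rmax_right by lra; intros u Hu.
    unfold Rabs in *; repeat destruct Rcase_abs; lra. }
  exact (row_sum_bound psi (M + s) s v N (L * s) ltac:(lra) s_gt0 Hsb Hpsi Hsupp).
Qed.
End OneVariable.

(** * Lipschitz functions of several variables, for the l1 distance *)

Definition dist1 (d : nat) (x y : vec) : R := sum_lt d (fun i => Rabs (x i - y i)).

Definition lipschitz (d : nat) (L : R) (f : vec -> R) : Prop :=
  0 <= L /\ forall x y, Rabs (f x - f y) <= L * dist1 d x y.

Definition supported (d : nat) (M : R) (f : vec -> R) : Prop :=
  forall x, f x <> 0 -> forall i, (i < d)%nat -> Rabs (x i) <= M.

Lemma sum_lt_le d u v : (forall i, (i < d)%nat -> u i <= v i) -> sum_lt d u <= sum_lt d v.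
Proof.
  induction d as [|d IH]; simpl; intros E; [lra|].
  apply Rplus_le_compat; [apply IH; auto|apply E; auto].
Qed.

Lemma sum_lt_nonneg d u : (forall i, (i < d)%nat -> 0 <= u i) -> 0 <= sum_lt d u.
Proof.
  induction d as [|d IH]; simpl; intros E; [lra|].
  apply Rplus_le_le_0_compat; [apply IH; auto|apply E; auto].
Qed.

Lemma sum_lt_ge_term d u i :
  (forall j, (j < d)%nat -> 0 <= u j) -> (i < d)%nat -> u i <= sum_lt d u.
Proof.
  induction d as [|d IH]; intros E Hi; [lia|]; simpl.
  pose proof (E d ltac:(lia)).
  assert (0 <= sum_lt d u) by (apply sum_lt_nonneg; auto).
  destruct (Nat.eq_dec i d) as [->|]; [lra|].
  assert (u i <= sum_lt d u) by (apply IH; [auto|lia]); lra.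
Qed.

Lemma sum_lt_scal d c u : sum_lt d (fun i => c * u i) = c * sum_lt d u.
Proof. induction d as [|d IH]; simpl; [|rewrite IH]; ring. Qed.

Lemma upd_same x d t : upd x d t d = t.
Proof. unfold upd; now rewrite Nat.eqb_refl. Qed.

Lemma upd_other x d t i : i <> d -> upd x d t i = x i.
Proof. intros E; unfold upd; now destruct (Nat.eqb_spec i d). Qed.

(** This additivity is the reason for working with the l1 distance: freezing or integrating out the
    last coordinate keeps the Lipschitz condition in the same form. *)
Lemma dist1_upd d x y t u :
  dist1 (S d) (upd x d t) (upd y d u) = dist1 d x y + Rabs (t - u).
Proof.
  unfold dist1; cbn [sum_lt]; rewrite !upd_same; f_equal.
  apply sum_lt_ext; intros i Hi; rewrite !upd_other by lia; reflexivity.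
Qed.

Lemma dist1_refl d x : dist1 d x x = 0.
Proof.
  unfold dist1; induction d as [|d IH]; simpl; [reflexivity|].
  rewrite IH, Rminus_diag, Rabs_R0; ring.
Qed.

Lemma riemann_sum_minus d N s v f g :
  riemann_sum d N s v (fun x => f x - g x) = riemann_sum d N s v f - riemann_sum d N s v g.
Proof. unfold riemann_sum; rewrite lsum_minus; ring. Qed.

(** Each coordinate costs a factor [2 * M + s <= 2 * M + 1], by [row_sum_bound] applied to the
    innermost row. *)
Lemma riemann_sum_bound d M B N s v f :
  0 <= M -> 0 < s <= 1 -> 0 <= B ->
  (forall x, Rabs (f x) <= B) -> supported d M f ->
  Rabs (riemann_sum d N s v f) <= B * (2 * M + 1) ^ d.
Proof.
  intros HM Hs; revert f B; induction d as [|d IH]; intros f B HB Hf Hsupp.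
  - unfold riemann_sum; simpl.
    replace ((f (fun _ => s * 0 + v _) + 0) * 1) with (f (fun i => s * 0 + v i)) by ring.
    rewrite Rmult_1_r; apply Hf.
  - rewrite riemann_sum_S; simpl pow; rewrite <- Rmult_assoc; apply IH.
    + apply Rmult_le_pos; lra.
    + intros x; eapply Rle_trans.
      * apply (row_sum_bound (fun t => f (upd x d t)) M s (v d) N B); auto; [lra|].
        intros t Ht; specialize (Hsupp _ Ht d ltac:(lia)); now rewrite upd_same in Hsupp.
      * apply Rmult_le_compat_l; lra.
    + intros x Hx i Hi; destruct (Rle_lt_dec (Rabs (x i)) M) as [|Hlt]; [assumption|].
      exfalso; apply Hx; rewrite (lsum_ext _ (fun _ => 0)), lsum_zero; [ring|].
      intros j; match goal with |- f ?y = 0 => destruct (Req_dec (f y) 0) as [|E] end;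
        [assumption|].
      specialize (Hsupp _ E i ltac:(lia)); rewrite upd_other in Hsupp by lia; lra.
Qed.

Lemma lipschitz_upd d L f x :
  lipschitz (S d) L f ->
  forall t u, Rabs (f (upd x d t) - f (upd x d u)) <= L * Rabs (t - u).
Proof.
  intros [HL Hf] t u; eapply Rle_trans; [apply Hf|].
  rewrite dist1_upd, dist1_refl; apply Rmult_le_compat_l; lra.
Qed.

Lemma supported_upd d M f x t :
  supported (S d) M f -> f (upd x d t) <> 0 -> Rabs t <= M.
Proof.
  intros Hsupp Ht; specialize (Hsupp _ Ht d ltac:(lia)); now rewrite upd_same in Hsupp.
Qed.

Lemma supported_upd_eq0 d M f x t i :
  supported (S d) M f -> (i < d)%nat -> M < Rabs (x i) -> f (upd x d t) = 0.
Proof.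
  intros Hsupp Hi Hlt.
  destruct (Req_dec (f (upd x d t)) 0) as [|E]; [assumption|].
  specialize (Hsupp _ E i ltac:(lia)); rewrite upd_other in Hsupp by lia; lra.
Qed.

(* The value [I] produced is the iterated integral, one coordinate at a time. *)
Lemma lipschitz_riemann_error d M : 0 <= M -> exists C, 0 <= C /\
  forall L f, lipschitz d L f -> supported d M f ->
  exists I, forall s v N, 0 < s <= 1 ->
    (forall i, (i < d)%nat -> M + Rabs (v i) <= s * INR N) ->
    Rabs (riemann_sum d N s v f - I) <= C * L * s.
Proof.
  intros HM; induction d as [|d (C & HC & IH)].
  - exists 0; split; [lra|]; intros L f [HL Hf] _; exists (f (fun _ => 0)); intros s v N Hs _.
    eapply Rle_trans; [|rewrite !Rmult_0_l; apply Rle_refl].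
    eapply Rle_trans; [|eapply Rle_trans; [apply (Hf (fun i => s * 0 + v i) (fun _ => 0))|]].
    + right; unfold riemann_sum; simpl; f_equal; ring.
    + unfold dist1; simpl; lra.
  (* The first term is the error for the partial integral [F], whose Lipschitz constant is
     [2 * M * L]. The second is the row error, at most [L * s * (2 * M + 3)] as [s <= 1], summed
     over the other [d] coordinates. *)
  - exists (C * (2 * M) + (2 * M + 3) * (2 * M + 1) ^ d).
    assert (H1 : 0 <= (2 * M + 1) ^ d) by (apply pow_le; lra).
    split; [nra|].
    intros L f Hlip Hsupp; pose proof (proj1 Hlip) as HL.
    set (F := fun x : vec => RInt (fun t => f (upd x d t)) (- M) M).
    assert (Hex : forall x a b, ex_RInt (fun t => f (upd x d t)) a b).
    { intros x a b; apply (lipschitz_ex_RInt _ L HL), lipschitz_upd, Hlip. }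
    assert (HF : lipschitz d (2 * M * L) F).
    { split; [nra|]; intros x y; unfold F.
      change (RInt (fun t => f (upd x d t)) (- M) M - RInt (fun t => f (upd y d t)) (- M) M)
        with (minus (RInt (fun t => f (upd x d t)) (- M) M)
                    (RInt (fun t => f (upd y d t)) (- M) M)).
      rewrite <- RInt_minus by apply Hex.
      replace (2 * M * L * dist1 d x y) with ((M - - M) * (L * dist1 d x y)) by ring.
      apply abs_RInt_le_const; [lra|apply (ex_RInt_minus (V := R_NormedModule)); apply Hex|].
      intros t _; change (Rabs (f (upd x d t) - f (upd y d t)) <= L * dist1 d x y).
      eapply Rle_trans; [apply Hlip|].
      rewrite dist1_upd, Rminus_diag, Rabs_R0, Rplus_0_r; lra. }
    assert (HFs : supported d M F).
    { intros x Hx i Hi; destruct (Rle_lt_dec (Rabs (x i)) M) as [|Hlt]; [assumption|].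
      exfalso; apply Hx; unfold F.
      rewrite (RInt_ext _ (fun _ => 0)), RInt_const.
      - unfold scal; simpl; unfold mult; simpl; ring.
      - intros t _; eapply supported_upd_eq0; eauto. }
    destruct (IH _ _ HF HFs) as (I & HI); exists I; intros s v N Hs HN.
    rewrite riemann_sum_S.
    set (Q := fun x => s * lsum (fun j => f (upd x d (s * IZR j + v d))) (zrange N)).
    replace (riemann_sum d N s v Q - I)
      with (riemann_sum d N s v (fun x => Q x - F x) + (riemann_sum d N s v F - I))
      by (rewrite riemann_sum_minus; ring).
    eapply Rle_trans; [apply Rabs_triang|].
    replace ((C * (2 * M) + (2 * M + 3) * (2 * M + 1) ^ d) * L * s)
      with (L * s * (2 * M + 3) * (2 * M + 1) ^ d + C * (2 * M * L) * s) by ring.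
    assert (HLs : 0 <= L * s) by nra.
    apply Rplus_le_compat; [|apply HI; auto].
    apply riemann_sum_bound; [lra|lra|nra| |].
    + intros x; eapply Rle_trans.
      * apply (row_sum_error (fun t => f (upd x d t)) L M s (v d) N HM (proj1 Hs) HL).
        -- apply lipschitz_upd, Hlip.
        -- intros t; apply supported_upd, Hsupp.
        -- apply HN; lia.
      * apply Rmult_le_compat_l; lra.
    + intros x Hx i Hi; destruct (Rle_lt_dec (Rabs (x i)) M) as [|Hlt]; [assumption|].
      exfalso; apply Hx.
      assert (E1 : F x = 0).
      { destruct (Req_dec (F x) 0) as [|E]; [assumption|].
        specialize (HFs _ E i Hi); lra. }
      assert (E2 : Q x = 0).
      { unfold Q; rewrite (lsum_ext _ (fun _ => 0)), lsum_zero; [ring|].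
        intros j; eapply supported_upd_eq0; eauto. }
      rewrite E1, E2; ring.
Qed.

Lemma large_step_count s M : 0 < s -> exists N0, forall N, (N0 <= N)%nat -> M <= s * INR N.
Proof.
  intros Hs; destruct (INR_unbounded (M / s)) as (N0 & H0).
  exists N0; intros N HN; apply le_INR in HN.
  apply Rmult_le_reg_l with (/ s); [now apply Rinv_0_lt_compat|].
  rewrite <- Rmult_assoc, Rinv_l, Rmult_1_l by lra.
  unfold Rdiv in H0; lra.
Qed.

Lemma grid_intro (P : R * vec * nat -> Prop) (M : vec -> R) delta :
  0 < delta ->
  (forall s v N, 0 < s < delta -> M v <= s * INR N -> P (s, v, N)) -> grid P.
Proof.
  intros Hd HP; exists delta; split; [assumption|]; intros s v Hs.
  destruct (large_step_count s (M v) (proj1 Hs)) as (N0 & HN).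
  exists N0; intros N Hle; apply HP; auto.
Qed.

Lemma error_filterlim (u : R * vec * nat -> R) I C (M : vec -> R) :
  0 <= C ->
  (forall s v N, 0 < s <= 1 -> M v <= s * INR N -> Rabs (u (s, v, N) - I) <= C * s) ->
  filterlim u grid (locally I).
Proof.
  intros HC Hu; apply (filterlim_locally (U := R_UniformSpace)); intros e.
  pose proof (cond_pos e) as He.
  assert (Hd : 0 < e / (C + 1)) by (apply Rdiv_lt_0_compat; lra).
  apply grid_intro with (M := M) (delta := Rmin 1 (e / (C + 1))).
  { apply Rmin_glb_lt; lra. }
  intros s v N Hs HN; change (Rabs (u (s, v, N) - I) < e).
  pose proof (Rmin_l 1 (e / (C + 1))); pose proof (Rmin_r 1 (e / (C + 1))).
  eapply Rle_lt_trans; [apply Hu; [lra|assumption]|].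
  assert (Hlt : s < e / (C + 1)) by lra.
  apply (Rmult_lt_compat_l (C + 1)) in Hlt; [|lra].
  replace ((C + 1) * (e / (C + 1))) with (pos e) in Hlt by (field; lra).
  lra.
Qed.

Lemma lipschitz_has_int d L M f :
  lipschitz d L f -> supported d M f -> exists I, has_int d f I.
Proof.
  intros Hlip Hsupp.
  assert (Hsupp' : supported d (Rmax 0 M) f).
  { intros x Hx i Hi; eapply Rle_trans; [apply (Hsupp x Hx i Hi)|apply Rmax_r]. }
  destruct (lipschitz_riemann_error d (Rmax 0 M) (Rmax_l _ _)) as (C & HC & HE).
  destruct (HE L f Hlip Hsupp') as (I & HI); exists I.
  apply error_filterlim with (C := C * L)
    (* A single threshold that dominates the requirement of every coordinate. *)
    (M := fun v => sum_lt d (fun i => Rmax 0 M + Rabs (v i))).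
  - apply Rmult_le_pos; [assumption|apply Hlip].
  - intros s v N Hs HN; apply HI; [assumption|].
    intros i Hi; eapply Rle_trans; [|exact HN].
    apply (sum_lt_ge_term d (fun i => Rmax 0 M + Rabs (v i))); [|assumption].
    intros j _; pose proof (Rabs_pos (v j)); pose proof (Rmax_l 0 M); lra.
Qed.

(** For a product the Riemann sum factors exactly, so the value of the integral is known and not
    only its existence. The hypothesis on [upd] says that [f] ignores the coordinate [d]. *)
Lemma has_int_prod d f a phi L M :
  0 <= M -> 0 <= L ->
  (forall x y, Rabs (phi x - phi y) <= L * Rabs (x - y)) ->
  (forall t, phi t <> 0 -> Rabs t <= M) ->
  (forall x t, f (upd x d t) = f x) ->
  has_int d f a ->
  has_int (S d) (fun x => f x * phi (x d)) (a * RInt phi (- M) M).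
Proof.
  intros HM HL Hphi Hsupp Hdep Hf.
  apply (filterlim_ext (fun t => mult (gsum d f t)
    (row_sum (fst (fst t)) (snd (fst t) d) (snd t) phi))).
  - intros [[s v] N]; unfold gsum; cbn [fst snd].
    rewrite riemann_sum_S; unfold riemann_sum, row_sum, mult; simpl.
    rewrite (lsum_ext (fun k => s * lsum _ _)
      (fun k => s * lsum (fun j => phi (s * IZR j + v d)) (zrange N)
                * f (fun i => s * IZR (k i) + v i))).
    + rewrite lsum_scal; ring.
    + intros k; rewrite Rmult_assoc; f_equal.
      rewrite Rmult_comm, <- lsum_scal; apply lsum_ext; intros j.
      now rewrite Hdep, upd_same.
  - eapply filterlim_comp_2; [exact Hf| |apply (filterlim_mult (K := R_AbsRing))].
    apply error_filterlim with (C := L * (2 * M + 3)) (M := fun v => M + Rabs (v d)).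
    + nra.
    + intros s v N Hs HN; cbn [fst snd].
      eapply Rle_trans; [apply (row_sum_error phi L); auto; lra|].
      assert (0 <= L * s) by nra; nra.
Qed.

(** * Jordan measurability *)

Definition unit_lipschitz (d : nat) (f : vec -> R) : Prop :=
  (forall x, 0 <= f x <= 1) /\ exists L, lipschitz d L f.

(** For an indicator this expresses Jordan measurability of a bounded set. Admitting values in
    [[0, 1]] lets the class contain indicators multiplied by a Gaussian. A support bound on [h] also
    bounds the supports of [f] and [g]. *)
Definition jordan (d : nat) (f : vec -> R) : Prop :=
  forall e, 0 < e -> exists g h M c,
    unit_lipschitz d g /\ unit_lipschitz d h /\ (forall x, g x <= f x <= h x) /\
    supported d M h /\ has_int d (fun x => h x - g x) c /\ c <= e.

Lemma lipschitz_minus d L K f g :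
  lipschitz d L f -> lipschitz d K g -> lipschitz d (L + K) (fun x => f x - g x).
Proof.
  intros [HL Hf] [HK Hg]; split; [lra|]; intros x y.
  replace (f x - g x - (f y - g y)) with ((f x - f y) + - (g x - g y)) by ring.
  eapply Rle_trans; [apply Rabs_triang|]; rewrite Rabs_Ropp.
  specialize (Hf x y); specialize (Hg x y); lra.
Qed.

Lemma Rabs_mult_minus_le a b a' b' p q :
  0 <= a <= 1 -> 0 <= b' <= 1 -> Rabs (a - a') <= p -> Rabs (b - b') <= q ->
  Rabs (a * b - a' * b') <= p + q.
Proof.
  intros Ha Hb Hp Hq.
  replace (a * b - a' * b') with ((a - a') * b' + a * (b - b')) by ring.
  eapply Rle_trans; [apply Rabs_triang|]; rewrite !Rabs_mult.
  rewrite (Rabs_pos_eq b'), (Rabs_pos_eq a) by lra.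
  pose proof (Rabs_pos (a - a')); pose proof (Rabs_pos (b - b')); nra.
Qed.

Lemma unit_lipschitz_mult d f g :
  unit_lipschitz d f -> unit_lipschitz d g -> unit_lipschitz d (fun x => f x * g x).
Proof.
  intros [Hf (L & HL & Lf)] [Hg (K & HK & Lg)]; split.
  - intros x; specialize (Hf x); specialize (Hg x); nra.
  - exists (L + K); split; [lra|]; intros x y; rewrite Rmult_plus_distr_r.
    apply Rabs_mult_minus_le; auto.
Qed.

Lemma supported_le d M f g :
  (forall x, 0 <= g x <= f x) -> supported d M f -> supported d M g.
Proof.
  intros Hgf Hf x Hx; apply Hf; specialize (Hgf x); lra.
Qed.

Lemma unit_lipschitz_has_int_minus d M g h :
  unit_lipschitz d g -> unit_lipschitz d h -> (forall x, g x <= h x) ->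
  supported d M h -> exists c, has_int d (fun x => h x - g x) c.
Proof.
  intros [Hg (L & Lg)] [Hh (K & Lh)] Hgh Hs.
  apply (lipschitz_has_int d (K + L) M); [apply lipschitz_minus; assumption|].
  apply supported_le with (2 := Hs); intros x.
  specialize (Hg x); specialize (Hh x); specialize (Hgh x); lra.
Qed.

Lemma jordan_range d f x : jordan d f -> 0 <= f x <= 1.
Proof.
  intros H; destruct (H 1 Rlt_0_1) as (g & h & _ & _ & [Hg _] & [Hh _] & Hf & _).
  specialize (Hg x); specialize (Hh x); specialize (Hf x); lra.
Qed.

Lemma jordan_supported d f : jordan d f -> exists M, supported d M f.
Proof.
  intros H; destruct (H 1 Rlt_0_1) as (g & h & M & _ & [Hg _] & _ & Hf & Hs & _).
  exists M; apply supported_le with (2 := Hs); intros x.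
  specialize (Hg x); specialize (Hf x); lra.
Qed.

Lemma jordan_has_int d f : jordan d f -> exists I, has_int d f I.
Proof.
  intros H; apply has_int_squeeze; intros e He.
  destruct (H e He) as (g & h & M & c & Hg & Hh & Hf & Hs & Hc & Hce).
  destruct Hh as [Hh1 (K & Lh)]; destruct Hg as [Hg1 (L & Lg)].
  destruct (lipschitz_has_int d K M h Lh Hs) as (b & Hb).
  destruct (lipschitz_has_int d L M g Lg) as (a & Ha).
  { apply supported_le with (2 := Hs); intros x; specialize (Hg1 x); specialize (Hf x); lra. }
  exists g, h, a, b; repeat split; try assumption; try apply Hf.
  rewrite (has_int_unique _ _ _ _ (has_int_minus _ _ _ _ _ Hb Ha) Hc); assumption.
Qed.

(** The products of the lower and of the upper cutoffs squeeze the product. As all values lie in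
    [[0, 1]], the new gap is at most the sum of the two gaps. *)
Lemma jordan_mult d f1 f2 : jordan d f1 -> jordan d f2 -> jordan d (fun x => f1 x * f2 x).
Proof.
  intros H1 H2 e He.
  destruct (H1 (e / 2) ltac:(lra)) as (g1 & h1 & M1 & c1 & Hg1 & Hh1 & Hf1 & Hs1 & Hc1 & He1).
  destruct (H2 (e / 2) ltac:(lra)) as (g2 & h2 & M2 & c2 & Hg2 & Hh2 & Hf2 & Hs2 & Hc2 & He2).
  assert (Hg : unit_lipschitz d (fun x => g1 x * g2 x)) by now apply unit_lipschitz_mult.
  assert (Hh : unit_lipschitz d (fun x => h1 x * h2 x)) by now apply unit_lipschitz_mult.
  assert (Hb : forall x, 0 <= g1 x /\ g1 x <= f1 x <= h1 x /\ h1 x <= 1 /\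
                         0 <= g2 x /\ g2 x <= f2 x <= h2 x /\ h2 x <= 1).
  { intros x; destruct Hg1 as [Hg1 _], Hh1 as [Hh1 _], Hg2 as [Hg2 _], Hh2 as [Hh2 _].
    specialize (Hg1 x); specialize (Hh1 x); specialize (Hg2 x); specialize (Hh2 x).
    specialize (Hf1 x); specialize (Hf2 x); lra. }
  assert (Hf : forall x, g1 x * g2 x <= f1 x * f2 x <= h1 x * h2 x).
  { intros x; specialize (Hb x); split; apply Rmult_le_compat; lra. }
  assert (Hs : supported d M1 (fun x => h1 x * h2 x)).
  { apply supported_le with (2 := Hs1); intros x; specialize (Hb x); nra. }
  destruct (unit_lipschitz_has_int_minus d M1 _ _ Hg Hh) as (c & Hc); [|assumption|].
  { intros x; specialize (Hf x); lra. }
  exists (fun x => g1 x * g2 x), (fun x => h1 x * h2 x), M1, c.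
  repeat (split; [assumption|]).
  enough (c <= c1 + c2) by lra.
  apply (has_int_le _ _ _ _ _) with (2 := Hc) (3 := has_int_plus _ _ _ _ _ Hc1 Hc2).
  intros x; specialize (Hb x).
  replace (h1 x * h2 x - g1 x * g2 x) with ((h1 x - g1 x) * h2 x + g1 x * (h2 x - g2 x)) by ring.
  nra.
Qed.

(** Not a case of [jordan_mult]: [phi] may have unbounded support, as a Gaussian does, and then is
    not [jordan] itself. *)
Lemma jordan_mult_lipschitz d f phi :
  jordan d f -> unit_lipschitz d phi -> jordan d (fun x => f x * phi x).
Proof.
  intros H Hphi e He.
  destruct (H e He) as (g & h & M & c & Hg & Hh & Hf & Hs & Hc & Hce).
  assert (Hb : forall x, 0 <= g x /\ g x <= f x <= h x /\ h x <= 1 /\ 0 <= phi x <= 1).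
  { intros x; destruct Hg as [Hg _], Hh as [Hh _], Hphi as [Hp _].
    specialize (Hg x); specialize (Hh x); specialize (Hp x); specialize (Hf x); lra. }
  assert (Hg' : unit_lipschitz d (fun x => g x * phi x)) by now apply unit_lipschitz_mult.
  assert (Hh' : unit_lipschitz d (fun x => h x * phi x)) by now apply unit_lipschitz_mult.
  assert (Hs' : supported d M (fun x => h x * phi x)).
  { apply supported_le with (2 := Hs); intros x; specialize (Hb x); nra. }
  destruct (unit_lipschitz_has_int_minus d M _ _ Hg' Hh') as (c' & Hc'); [|assumption|].
  { intros x; specialize (Hb x); nra. }
  exists (fun x => g x * phi x), (fun x => h x * phi x), M, c'.
  repeat (split; [first [assumption | intros x; specialize (Hb x); nra]|]).
  eapply Rle_trans; [|exact Hce].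
  apply (has_int_le _ _ _ _ _) with (2 := Hc') (3 := Hc).
  intros x; specialize (Hb x); nra.
Qed.

(** * Star-shaped bodies with a Lipschitz gauge *)

Definition clamp (t : R) : R := Rmax 0 (Rmin 1 t).

Ltac clamp_cases := unfold clamp, Rmax, Rmin; repeat destruct Rle_dec; try lra.

Lemma clamp_range t : 0 <= clamp t <= 1.
Proof. clamp_cases. Qed.

Lemma clamp_lipschitz t u : Rabs (clamp t - clamp u) <= Rabs (t - u).
Proof. unfold Rabs; repeat destruct Rcase_abs; revert r; try revert r0; clamp_cases. Qed.

Lemma unit_lipschitz_clamp d rho L x0 a b :
  lipschitz d L rho ->
  unit_lipschitz d (fun x => clamp (a - b * rho (vsub x x0))).
Proof.
  intros [HL Hr]; split; [intros; apply clamp_range|].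
  exists (Rabs b * L); split; [apply Rmult_le_pos; [apply Rabs_pos|assumption]|].
  intros x y; eapply Rle_trans; [apply clamp_lipschitz|].
  replace (a - b * rho (vsub x x0) - (a - b * rho (vsub y x0)))
    with (- b * (rho (vsub x x0) - rho (vsub y x0))) by ring.
  rewrite Rabs_mult, Rabs_Ropp, Rmult_assoc; apply Rmult_le_compat_l; [apply Rabs_pos|].
  eapply Rle_trans; [apply Hr|]; right; f_equal.
  apply sum_lt_ext; intros i _; unfold vsub; f_equal; ring.
Qed.

Lemma bernoulli_minus d t : 0 <= t <= 1 -> 1 - INR d * t <= (1 - t) ^ d.
Proof.
  intros Ht; induction d as [|d IH]; [simpl; lra|].
  rewrite S_INR; simpl pow.
  pose proof (pos_INR d); apply (Rmult_le_compat_l (1 - t)) in IH; [|lra]; nra.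
Qed.

(* With [1 / delta] the slope of the inner cutoff, the outer one is its dilate by
   [1 / (1 - delta)], so the gap between them is [1 - (1 - delta) ^ d] times the outer one. *)
Lemma star_jordan d rho L M x0 f :
  lipschitz d L rho ->
  (forall l z, 0 < l -> rho (fun i => l * z i) = l * rho z) ->
  (forall z, rho z <= 1 -> forall i, (i < d)%nat -> Rabs (z i) <= M) ->
  (forall x, 0 <= f x <= 1) ->
  (forall x, rho (vsub x x0) < 1 -> f x = 1) ->
  (forall x, f x <> 0 -> rho (vsub x x0) <= 1) ->
  jordan d f.
Proof.
  intros Hlip Hhom Hbd Hf01 Hf1 Hf0 e He.
  (* A bound for all coordinates on the region [rho <= 3], which contains the supports of all the
     cutoffs below. *)
  set (M' := 3 * Rabs M + sum_lt d (fun i => Rabs (x0 i))).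
  assert (Hsup : forall F : vec -> R, (forall x, F x <> 0 -> rho (vsub x x0) <= 3) ->
                 supported d M' F).
  { intros F HF x Hx i Hi.
    assert (H3 : Rabs (/ 3 * vsub x x0 i) <= M).
    { apply (Hbd (fun j => / 3 * vsub x x0 j)); [|assumption].
      rewrite Hhom by lra; specialize (HF x Hx); lra. }
    rewrite Rabs_mult, Rabs_pos_eq in H3 by lra.
    pose proof (sum_lt_ge_term d (fun i => Rabs (x0 i)) i (fun j _ => Rabs_pos _) Hi).
    replace (x i) with (vsub x x0 i + x0 i) by (unfold vsub; ring).
    eapply Rle_trans; [apply Rabs_triang|]; unfold M'.
    pose proof (Rle_abs M); simpl in *; lra. }
  (* The function [clamp (3 - rho)] is 1 up to [rho = 2] and 0 from [rho = 3] on. It dominates every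
     outer cutoff [h], so its integral [V] is a bound chosen before [delta]. *)
  destruct (unit_lipschitz_clamp d rho L x0 3 1 Hlip) as [_ (LH & HLH)].
  destruct (lipschitz_has_int d LH M' _ HLH) as (V & HV).
  { apply Hsup; intros x Hx; apply Rnot_lt_le; intros Hlt; apply Hx.
    clamp_cases. }
  assert (HV0 : 0 <= V).
  { apply (has_int_nonneg d) with (2 := HV); intros; apply clamp_range. }
  (* The bound [1 / 2] makes [h] vanish from [rho = 2] on; the other makes [delta * (INR d * V)],
     which bounds the gap by Bernoulli's inequality, at most [e]. *)
  set (delta := Rmin (1 / 2) (e / (INR d * V + 1))).
  pose proof (pos_INR d) as Hd0.
  assert (HdV : 0 <= INR d * V) by now apply Rmult_le_pos.
  assert (Hdelta : 0 < delta <= 1 / 2).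
  { split; [|apply Rmin_l]; apply Rmin_glb_lt; [lra|apply Rdiv_lt_0_compat; lra]. }
  assert (Hdelta2 : delta * (INR d * V) <= e).
  { assert (H : delta <= e / (INR d * V + 1)) by apply Rmin_r.
    apply (Rmult_le_compat_r (INR d * V + 1)) in H; [|lra].
    replace (e / (INR d * V + 1) * (INR d * V + 1)) with e in H by (field; lra); nra. }
  set (g := fun x => clamp (/ delta - / delta * rho (vsub x x0))).
  set (h := fun x => clamp (/ delta - (1 - delta) / delta * rho (vsub x x0))).
  assert (Hinv : 0 < / delta) by (apply Rinv_0_lt_compat; lra).
  assert (Hg : unit_lipschitz d g) by (apply unit_lipschitz_clamp with L; assumption).
  assert (Hh : unit_lipschitz d h) by (apply unit_lipschitz_clamp with L; assumption).
  assert (Hgf : forall x, g x <= f x).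
  { intros x; destruct (Rlt_le_dec (rho (vsub x x0)) 1) as [Hr|Hr].
    - rewrite Hf1 by assumption; apply clamp_range.
    - replace (g x) with 0; [apply Hf01|]; unfold g.
      assert (/ delta - / delta * rho (vsub x x0) <= 0) by nra; clamp_cases. }
  assert (Hfh : forall x, f x <= h x).
  { intros x; destruct (Rle_lt_dec (rho (vsub x x0)) 1) as [Hr|Hr].
    - replace (h x) with 1; [apply Hf01|]; unfold h.
      assert (H1 : 1 <= / delta - (1 - delta) / delta * rho (vsub x x0)); [|clamp_cases].
      replace (/ delta - (1 - delta) / delta * rho (vsub x x0))
        with (1 + (1 - delta) / delta * (1 - rho (vsub x x0))) by (field; lra).
      assert (0 <= (1 - delta) / delta) by (apply Rmult_le_pos; lra); nra.
    - destruct (Req_dec (f x) 0) as [->|E]; [apply clamp_range|].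
      apply Hf0 in E; lra. }
  assert (Hh2 : forall x, 0 < h x -> rho (vsub x x0) < 2).
  { intros x Hx; apply Rnot_le_lt; intros Hr; revert Hx; apply Rle_not_lt; unfold h.
    assert (/ delta - (1 - delta) / delta * rho (vsub x x0) <= 0); [|clamp_cases].
    replace (/ delta - (1 - delta) / delta * rho (vsub x x0))
      with (/ delta * (1 - (1 - delta) * rho (vsub x x0))) by (field; lra).
    assert ((1 - delta) * rho (vsub x x0) >= 1) by nra; nra. }
  assert (Hhs : supported d M' h).
  { apply Hsup; intros x Hx; assert (0 <= h x) by apply clamp_range.
    assert (rho (vsub x x0) < 2) by (apply Hh2; lra); lra. }
  destruct Hg as [Hg01 (Lg & HLg)].
  destruct (lipschitz_has_int d Lg M' g HLg) as (a & Ha).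
  { apply supported_le with (2 := Hhs); intros x.
    specialize (Hg01 x); specialize (Hgf x); specialize (Hfh x); lra. }
  assert (Hh' : has_int d h (a / (1 - delta) ^ d)).
  { apply (has_int_ext d (fun x => g (fun i => (1 - delta) * x i + delta * x0 i))).
    - intros x; unfold g, h; f_equal.
      replace (vsub (fun i => (1 - delta) * x i + delta * x0 i) x0)
        with (fun i => (1 - delta) * vsub x x0 i)
        by (apply functional_extensionality; intros i; unfold vsub; ring).
      rewrite Hhom by lra; field; lra.
    - apply has_int_affine; [lra|assumption]. }
  exists g, h, M', (a / (1 - delta) ^ d - a).
  split; [split; eauto|]; split; [assumption|].
  split; [intros; split; auto|]; split; [assumption|].
  split; [now apply has_int_minus|].
  assert (Hp : 0 < (1 - delta) ^ d) by (apply pow_lt; lra).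
  set (b := a / (1 - delta) ^ d) in *.
  replace a with (b * (1 - delta) ^ d) by (unfold b; field; lra).
  assert (HbV : b <= V).
  { apply (has_int_le d) with (2 := Hh') (3 := HV); intros x.
    destruct (Rle_lt_dec (h x) 0) as [Hr|Hr].
    - eapply Rle_trans; [exact Hr|apply clamp_range].
    - specialize (Hh2 x Hr); replace (clamp (3 - 1 * rho (vsub x x0))) with 1
        by clamp_cases; apply clamp_range. }
  assert (Hb0 : 0 <= b).
  { apply (has_int_nonneg d) with (2 := Hh'); intros; apply clamp_range. }
  assert (HB := bernoulli_minus d delta ltac:(lra)).
  apply Rle_trans with (delta * (INR d * V)); [|assumption].
  apply Rle_trans with (b * (INR d * delta)); [nra|].
  assert (0 <= INR d * delta) by nra; nra.
Qed.

(** * Euclidean balls *)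

Definition nrm (d : nat) (z : vec) : R := sqrt (norm2 d z).

Lemma norm2_nonneg d z : 0 <= norm2 d z.
Proof. apply sum_lt_nonneg; intros; apply Rle_0_sqr. Qed.

Lemma nrm_nonneg d z : 0 <= nrm d z.
Proof. apply sqrt_pos. Qed.

Lemma nrm_sqr d z : nrm d z * nrm d z = norm2 d z.
Proof. apply sqrt_sqrt, norm2_nonneg. Qed.

Lemma norm2_scal d l z : norm2 d (fun i => l * z i) = l * l * norm2 d z.
Proof.
  unfold norm2; rewrite <- sum_lt_scal; apply sum_lt_ext; intros; ring.
Qed.

Lemma nrm_scal d l z : 0 <= l -> nrm d (fun i => l * z i) = l * nrm d z.
Proof.
  intros Hl; unfold nrm; rewrite norm2_scal, sqrt_mult, sqrt_square;
    [reflexivity|assumption|nra|apply norm2_nonneg].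
Qed.

Lemma Rabs_le_nrm d z i : (i < d)%nat -> Rabs (z i) <= nrm d z.
Proof.
  intros Hi; unfold nrm; rewrite <- sqrt_Rsqr_abs; apply sqrt_le_1_alt.
  apply (sum_lt_ge_term d (fun i => z i * z i)); [|assumption].
  intros; apply Rle_0_sqr.
Qed.

(** The induction step for [nrm_lipschitz]: [a] and [b] are the norms of the first coordinates, [x]
    and [y] the last coordinates. Squaring reduces it to the fact that [b] and [|y|] are at most the
    root on the right. *)
Lemma sqrt_plus_sqr_le a x b y :
  0 <= a -> 0 <= b ->
  sqrt (a * a + x * x) <= sqrt (b * b + y * y) + (Rabs (a - b) + Rabs (x - y)).
Proof.
  intros Ha Hb.
  set (B := sqrt (b * b + y * y)).
  assert (HB0 : 0 <= B) by apply sqrt_pos.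
  assert (HB : B * B = b * b + y * y) by (apply sqrt_sqrt; nra).
  assert (H1 : b <= B) by nra.
  assert (H2 : Rabs y <= B).
  { apply Rsqr_incr_0_var; [|assumption]; rewrite <- Rsqr_abs; unfold Rsqr; nra. }
  assert (H3 : a <= b + Rabs (a - b)) by (pose proof (Rle_abs (a - b)); lra).
  assert (H4 : Rabs x <= Rabs y + Rabs (x - y)).
  { replace x with (y + (x - y)) at 1 by ring; apply Rabs_triang. }
  assert (H5 : x * x = Rabs x * Rabs x) by apply Rsqr_abs.
  assert (H6 : y * y = Rabs y * Rabs y) by apply Rsqr_abs.
  pose proof (Rabs_pos (a - b)) as P1; pose proof (Rabs_pos (x - y)) as P2.
  pose proof (Rabs_pos x) as P3; pose proof (Rabs_pos y) as P4.
  rewrite H5; rewrite H6 in HB; clear H5 H6.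
  revert H2 H3 H4 P1 P2 P3 P4 HB; generalize (Rabs (a - b)), (Rabs (x - y)), (Rabs x), (Rabs y).
  intros p q X Y H2 H3 H4 P1 P2 P3 P4 HB.
  rewrite <- (sqrt_square (B + (p + q))) by lra; apply sqrt_le_1_alt.
  assert (a * a <= (b + p) * (b + p)) by nra.
  assert (X * X <= (Y + q) * (Y + q)) by nra.
  assert (b * p <= B * p) by nra.
  assert (Y * q <= B * q) by nra.
  nra.
Qed.

Lemma nrm_lipschitz d : lipschitz d 1 (nrm d).
Proof.
  split; [lra|]; intros x y; rewrite Rmult_1_l.
  enough (H : forall x y, nrm d x <= nrm d y + dist1 d x y).
  { apply Rabs_le; pose proof (H x y); pose proof (H y x).
    replace (dist1 d y x) with (dist1 d x y) in *; [lra|].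
    apply sum_lt_ext; intros; apply Rabs_minus_sym. }
  clear x y; induction d as [|d IH]; intros x y; [unfold nrm, norm2, dist1; simpl; lra|].
  unfold nrm, norm2, dist1; cbn [sum_lt].
  fold (norm2 d x) (norm2 d y) (dist1 d x y); rewrite <- !nrm_sqr.
  eapply Rle_trans; [apply sqrt_plus_sqr_le; apply nrm_nonneg|].
  apply Rplus_le_compat_l, Rplus_le_compat_r, Rabs_le.
  pose proof (IH x y); pose proof (IH y x).
  replace (dist1 d y x) with (dist1 d x y) in *; [lra|].
  apply sum_lt_ext; intros; apply Rabs_minus_sym.
Qed.

Lemma in_ball_nrm d c r x : 0 <= r -> in_ball d c r x <-> nrm d (vsub x c) < r.
Proof.
  intros Hr; unfold in_ball; rewrite <- nrm_sqr; pose proof (nrm_nonneg d (vsub x c)).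
  split; nra.
Qed.

Lemma indic_true (A : vec -> Prop) x : A x -> indic A x = 1.
Proof. intros H; unfold indic; now destruct excluded_middle_informative. Qed.

Lemma indic_false (A : vec -> Prop) x : ~ A x -> indic A x = 0.
Proof. intros H; unfold indic; now destruct excluded_middle_informative. Qed.

Lemma indic_neq0 (A : vec -> Prop) x : indic A x <> 0 -> A x.
Proof. unfold indic; destruct excluded_middle_informative; [trivial|lra]. Qed.

Lemma indic_range A x : 0 <= indic A x <= 1.
Proof. unfold indic; destruct excluded_middle_informative; lra. Qed.

Lemma indic_iff (A B : vec -> Prop) x y : (A x <-> B y) -> indic A x = indic B y.
Proof. intros H; unfold indic; repeat destruct excluded_middle_informative; tauto. Qed.

Lemma ball_jordan d c r : 0 < r -> jordan d (indic (in_ball d c r)).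
Proof.
  intros Hr; apply (star_jordan d (fun z => nrm d z / r) (/ r) r c).
  - pose proof (Rinv_0_lt_compat r Hr); destruct (nrm_lipschitz d) as [_ Hl].
    split; [lra|]; intros x y.
    replace (nrm d x / r - nrm d y / r) with ((nrm d x - nrm d y) * / r) by (field; lra).
    rewrite Rabs_mult, (Rabs_pos_eq (/ r)) by lra; rewrite Rmult_comm.
    apply Rmult_le_compat_l; [lra|]; specialize (Hl x y); lra.
  - intros l z Hl; rewrite nrm_scal by lra; field; lra.
  - intros z Hz i Hi; eapply Rle_trans; [apply Rabs_le_nrm, Hi|].
    now apply Rle_div_l in Hz; [rewrite Rmult_1_l in Hz|].
  - intros; apply indic_range.
  - intros x Hx; apply indic_true, in_ball_nrm; [lra|].
    now apply Rlt_div_l in Hx; [rewrite Rmult_1_l in Hx|].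
  - intros x Hx; apply indic_neq0, in_ball_nrm in Hx; [|lra].
    apply Rle_div_l; lra.
Qed.

(** Every ball is an affine image of the unit ball, so one constant serves all centres and radii.
    Its positivity is obtained in [ball_volume]. *)
Lemma ball_has_int d :
  exists V, forall c r, 0 < r -> has_int d (indic (in_ball d c r)) (r ^ d * V).
Proof.
  destruct (jordan_has_int d _ (ball_jordan d (fun _ => 0) 1 Rlt_0_1)) as (V & HV).
  exists V; intros c r Hr.
  pose proof (Rinv_0_lt_compat r Hr) as Hi.
  replace (r ^ d * V) with (V / (/ r) ^ d).
  2:{ rewrite pow_inv; field; apply pow_nonzero; lra. }
  apply (has_int_ext d (fun x => indic (in_ball d (fun _ => 0) 1)
                          (fun i => / r * x i + - c i / r))).
  - intros x; apply indic_iff; rewrite !in_ball_nrm by lra.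
    replace (vsub (fun i => / r * x i + - c i / r) (fun _ => 0))
      with (fun i => / r * vsub x c i)
      by (apply functional_extensionality; intros i; unfold vsub; field; lra).
    rewrite nrm_scal by lra.
    split; intros H.
    + apply (Rmult_lt_compat_l r) in H; [|assumption].
      rewrite <- Rmult_assoc, Rinv_r in H; lra.
    + apply Rmult_lt_reg_l with r; [assumption|]; rewrite <- Rmult_assoc, Rinv_r; lra.
  - now apply has_int_affine.
Qed.

(** * Polytopes *)

Lemma dot_axpy d a l z x : dot d a (fun i => l * z i + x i) = l * dot d a z + dot d a x.
Proof. unfold dot; induction d as [|d IH]; simpl; [ring|]; rewrite IH; ring. Qed.

Lemma dot_scal d a l z : dot d a (fun i => l * z i) = l * dot d a z.
Proof. unfold dot; rewrite <- sum_lt_scal; apply sum_lt_ext; intros; ring. Qed.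

Lemma dot_vsub d a x y : dot d a (vsub x y) = dot d a x - dot d a y.
Proof. unfold dot, vsub; induction d as [|d IH]; simpl; [ring|]; rewrite IH; ring. Qed.

Lemma Rabs_dot_le d a z b :
  (forall i, (i < d)%nat -> Rabs (z i) <= b) ->
  Rabs (dot d a z) <= sum_lt d (fun i => Rabs (a i)) * b.
Proof.
  intros Hz; unfold dot; induction d as [|d IH]; simpl; [rewrite Rabs_R0; lra|].
  eapply Rle_trans; [apply Rabs_triang|]; rewrite Rabs_mult, Rmult_plus_distr_r.
  apply Rplus_le_compat; [apply IH; auto|].
  apply Rmult_le_compat_l; [apply Rabs_pos|auto].
Qed.

Lemma dot_lipschitz d a : lipschitz d (sum_lt d (fun i => Rabs (a i))) (dot d a).
Proof.
  split; [apply sum_lt_nonneg; intros; apply Rabs_pos|]; intros x y.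
  rewrite <- dot_vsub; apply Rabs_dot_le; intros i Hi.
  apply (sum_lt_ge_term d (fun i => Rabs (x i - y i))); [intros; apply Rabs_pos|assumption].
Qed.

(* A constraint without slack at the interior point [x0] has a zero normal vector;
   it then contributes [0 / 0 = 0]. *)
Definition gauge (d : nat) (x0 : vec) (H : list (vec * R)) (z : vec) : R :=
  fold_right (fun h m => Rmax (dot d (fst h) z / (snd h - dot d (fst h) x0)) m) 0 H.

Lemma gauge_lipschitz d x0 H : exists L, lipschitz d L (gauge d x0 H).
Proof.
  induction H as [|h H (K & HK & IH)]; simpl.
  - exists 0; split; [lra|]; intros; unfold gauge; simpl; rewrite Rminus_diag, Rabs_R0; lra.
  - set (c := / (snd h - dot d (fst h) x0)).
    set (B := sum_lt d (fun i => Rabs (fst h i))).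
    destruct (dot_lipschitz d (fst h)) as [HB Hdot]; fold B in HB, Hdot.
    assert (HBc : 0 <= B * Rabs c) by (apply Rmult_le_pos; [assumption|apply Rabs_pos]).
    exists (B * Rabs c + K); split; [lra|].
    intros x y; specialize (IH x y); specialize (Hdot x y).
    assert (H1 : Rabs (dot d (fst h) x * c - dot d (fst h) y * c) <= B * Rabs c * dist1 d x y).
    { rewrite <- Rmult_minus_distr_r, Rabs_mult.
      pose proof (Rabs_pos c); nra. }
    rewrite Rmult_plus_distr_r.
    change (gauge d x0 (h :: H)) with (fun z => Rmax (dot d (fst h) z * c) (gauge d x0 H z)).
    cbv beta; apply Rabs_le_between in H1; apply Rabs_le_between in IH; apply Rabs_le_between.
    unfold Rmax; repeat destruct Rle_dec; lra.
Qed.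

Lemma gauge_scal d x0 H l z :
  0 < l -> gauge d x0 H (fun i => l * z i) = l * gauge d x0 H z.
Proof.
  intros Hl; induction H as [|h H IH]; simpl; [ring|].
  unfold gauge in *; simpl; rewrite IH, dot_scal, <- RmaxRmult by lra.
  f_equal; unfold Rdiv; ring.
Qed.

(** For each direction [z] the ball contains [x0 + t z] and [x0 - t z] for some [t > 0], so
    [t * |a . z|] is at most the slack. If the slack is 0, then [a] is orthogonal to everything. *)
Lemma halfspace_slack d a b x0 r0 :
  0 < r0 -> (forall x, in_ball d x0 r0 x -> dot d a x <= b) ->
  0 <= b - dot d a x0 /\ (b - dot d a x0 = 0 -> forall z, dot d a z = 0).
Proof.
  intros Hr H.
  assert (Hb : forall z, exists t, 0 < t /\ t * Rabs (dot d a z) <= b - dot d a x0).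
  (* The added 1 covers [nrm d z = 0] and keeps the displaced points strictly inside the ball. *)
  { intros z; set (t := r0 / (nrm d z + 1)); pose proof (nrm_nonneg d z) as Hz.
    assert (Ht : 0 < t) by (apply Rdiv_lt_0_compat; lra).
    assert (Hin : forall s, Rabs s = t -> s * dot d a z <= b - dot d a x0).
    { intros s Hs; enough (s * dot d a z + dot d a x0 <= b) by lra.
      rewrite <- dot_axpy; apply H, in_ball_nrm; [lra|].
      replace (vsub (fun i => s * z i + x0 i) x0) with (fun i => s * z i)
        by (apply functional_extensionality; intros i; unfold vsub; ring).
      replace (nrm d (fun i => s * z i)) with (t * nrm d z).
      - unfold t; apply Rmult_lt_reg_r with (nrm d z + 1); [lra|].
        replace (r0 / (nrm d z + 1) * nrm d z * (nrm d z + 1)) with (r0 * nrm d z)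
          by (field; lra); nra.
      - rewrite <- nrm_scal by lra; unfold nrm; f_equal; rewrite !norm2_scal; f_equal.
        rewrite <- Hs; symmetry; apply Rsqr_abs. }
    exists t; split; [assumption|].
    destruct (Rle_lt_dec 0 (dot d a z)).
    - rewrite (Rabs_pos_eq (dot d a z)) by assumption; apply Hin, Rabs_pos_eq; lra.
    - rewrite (Rabs_left (dot d a z)) by assumption.
      replace (t * - dot d a z) with (- t * dot d a z) by ring.
      apply Hin; rewrite Rabs_Ropp; apply Rabs_pos_eq; lra. }
  split.
  - destruct (Hb x0) as (t & Ht & Hle); pose proof (Rabs_pos (dot d a x0)); nra.
  - intros E z; destruct (Hb z) as (t & Ht & Hle); rewrite E in Hle.
    pose proof (Rabs_pos (dot d a z)) as Hp.
    destruct (Req_dec (dot d a z) 0) as [|N]; [assumption|].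
    apply Rabs_pos_lt in N; nra.
Qed.

Lemma in_poly_gauge d H x0 r0 :
  0 < r0 -> (forall x, in_ball d x0 r0 x -> in_poly d H x) ->
  forall x, in_poly d H x <-> gauge d x0 H (vsub x x0) <= 1.
Proof.
  intros Hr; induction H as [|[a b] H IH]; intros Hball x.
  - unfold gauge; simpl; split; [lra|constructor].
  - assert (Hh : forall x, in_ball d x0 r0 x -> dot d a x <= b).
    { intros y Hy; specialize (Hball y Hy); now inversion Hball. }
    assert (HH : forall x, in_ball d x0 r0 x -> in_poly d H x).
    { intros y Hy; specialize (Hball y Hy); now inversion Hball. }
    destruct (halfspace_slack d a b x0 r0 Hr Hh) as [Hc0 Hc].
    unfold in_poly; rewrite Forall_cons_iff; fold (in_poly d H x).
    rewrite (IH HH x).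
    change (gauge d x0 ((a, b) :: H) (vsub x x0))
      with (Rmax (dot d a (vsub x x0) / (b - dot d a x0)) (gauge d x0 H (vsub x x0))).
    assert (E : dot d a x <= b <-> dot d a (vsub x x0) / (b - dot d a x0) <= 1).
    { destruct (Req_dec (b - dot d a x0) 0) as [E|E].
      (* Here [b] is 0 as well, so the constraint reads [0 <= 0] and agrees with [0 <= 1]. *)
      - rewrite E; unfold Rdiv; rewrite Rinv_0, Rmult_0_r; rewrite (Hc E x).
        rewrite (Hc E x0) in E; lra.
      - rewrite Rle_div_l, dot_vsub by lra; lra. }
    cbn [fst snd]; rewrite E; split.
    + intros [K1 K2]; now apply Rmax_lub.
    + intros K; split; eapply Rle_trans; [apply Rmax_l|exact K|apply Rmax_r|exact K].
Qed.

Lemma poly_jordan d H : full_dim_polytope d H -> jordan d (indic (in_poly d H)).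
Proof.
  intros [(M & HM) (x0 & r0 & Hr & Hball)].
  destruct (gauge_lipschitz d x0 H) as (L & HL).
  pose proof (in_poly_gauge d H x0 r0 Hr Hball) as Hg.
  apply (star_jordan d (gauge d x0 H) L (M + sum_lt d (fun i => Rabs (x0 i))) x0).
  - assumption.
  - intros; now apply gauge_scal.
  - intros z Hz i Hi.
    assert (Hin : in_poly d H (fun i => z i + x0 i)).
    { apply Hg; replace (vsub (fun i => z i + x0 i) x0) with z; [assumption|].
      apply functional_extensionality; intros j; unfold vsub; ring. }
    apply HM with (i := i) in Hin; [|assumption].
    pose proof (sum_lt_ge_term d (fun i => Rabs (x0 i)) i (fun j _ => Rabs_pos _) Hi) as Hs.
    replace (z i) with (z i + x0 i + - x0 i) by ring.
    eapply Rle_trans; [apply Rabs_triang|]; rewrite Rabs_Ropp; simpl in *; lra.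
  - intros; apply indic_range.
  - intros x Hx; apply indic_true, Hg; lra.
  - intros x Hx; now apply Hg, indic_neq0.
Qed.

(** A constraint with equality at [x] is homogeneous in [z]. Any other constraint keeps near [x] the
    truth value it has at [x], satisfied or violated, since [|a . z|] stays below [|b - a . x|].
    Hence [x] may lie anywhere, also outside the polytope. *)
Lemma poly_locally_conic d H x :
  exists r1, 0 < r1 /\ forall z l, nrm d z < r1 -> 0 < l <= 1 ->
    (in_poly d H (fun i => l * z i + x i) <-> in_poly d H (fun i => z i + x i)).
Proof.
  induction H as [|[a b] H (r1 & Hr1 & IH)].
  - exists 1; split; [lra|]; intros; split; constructor.
  - set (K := sum_lt d (fun i => Rabs (a i)) + 1).
    assert (HK : 1 <= K).
    { pose proof (sum_lt_nonneg d (fun i => Rabs (a i)) (fun i _ => Rabs_pos _)).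
      unfold K; lra. }
    assert (Hdot : forall z, Rabs (dot d a z) <= K * nrm d z).
    { intros z; eapply Rle_trans; [apply (Rabs_dot_le d a z (nrm d z))|].
      - intros; now apply Rabs_le_nrm.
      - pose proof (nrm_nonneg d z); unfold K; nra. }
    assert (Hex : exists r, 0 < r /\ forall z l, nrm d z < r -> 0 < l <= 1 ->
      (l * dot d a z + dot d a x <= b <-> 1 * dot d a z + dot d a x <= b)).
    { destruct (Req_dec (dot d a x) b) as [E|E].
      - exists 1; split; [lra|]; intros z l _ Hl; rewrite E; split; nra.
      - exists (Rabs (b - dot d a x) / K); split.
        + apply Rdiv_lt_0_compat; [apply Rabs_pos_lt|]; lra.
        + intros z l Hz Hl; specialize (Hdot z).
          apply (Rlt_div_r (nrm d z)) in Hz; [|lra].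
          assert (Hlt : Rabs (dot d a z) < Rabs (b - dot d a x)) by lra.
          pose proof (Rabs_pos (dot d a z)) as Hp.
          assert (Hl2 : Rabs (l * dot d a z) <= Rabs (dot d a z)).
          { rewrite Rabs_mult, (Rabs_pos_eq l) by lra; nra. }
          revert Hlt Hl2 Hp; unfold Rabs; repeat destruct Rcase_abs; intros; lra. }
    destruct Hex as (r2 & Hr2 & H2).
    exists (Rmin r1 r2); split; [now apply Rmin_glb_lt|]; intros z l Hz Hl.
    pose proof (Rmin_l r1 r2); pose proof (Rmin_r r1 r2).
    unfold in_poly; rewrite !Forall_cons_iff.
    fold (in_poly d H (fun i => l * z i + x i)) (in_poly d H (fun i => z i + x i)).
    rewrite IH by lra; cbn [fst snd].
    assert (E : dot d a (fun i => z i + x i) = 1 * dot d a z + dot d a x).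
    { rewrite <- dot_axpy; f_equal; apply functional_extensionality; intros; ring. }
    rewrite E, dot_axpy, H2 by lra; reflexivity.
Qed.

Lemma indic_and (A B : vec -> Prop) x :
  indic (fun y => A y /\ B y) x = indic A x * indic B x.
Proof. unfold indic; repeat destruct excluded_middle_informative; try lra; tauto. Qed.

(** The dilation about [x] by [r / r1] carries the part of the polytope in the ball of radius [r1]
    onto its part in the ball of radius [r]. Both volumes scale by the same power, so the ratio
    found at [r1] holds at all smaller radii. *)
Lemma ball_poly_has_int d H V x :
  full_dim_polytope d H -> 0 < V ->
  (forall c r, 0 < r -> has_int d (indic (in_ball d c r)) (r ^ d * V)) ->
  exists r1 w, 0 < r1 /\ 0 <= w /\ forall r, 0 < r <= r1 ->
    has_int d (fun y => indic (in_ball d x r) y * indic (in_poly d H) y) (w * (r ^ d * V)).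
Proof.
  intros HP HV Hball.
  destruct (poly_locally_conic d H x) as (r1 & Hr1 & Hcone).
  assert (Hex : forall r, 0 < r ->
    exists I, has_int d (fun y => indic (in_ball d x r) y * indic (in_poly d H) y) I).
  { intros r Hr; apply jordan_has_int, jordan_mult;
      [now apply ball_jordan|now apply poly_jordan]. }
  destruct (Hex r1 Hr1) as (I1 & HI1).
  assert (Hp1 : 0 < r1 ^ d) by now apply pow_lt.
  exists r1, (I1 / (r1 ^ d * V)); split; [assumption|]; split.
  { apply Rmult_le_pos; [|now apply Rlt_le, Rinv_0_lt_compat, Rmult_lt_0_compat].
    apply (has_int_nonneg d) with (2 := HI1); intros y.
    pose proof (indic_range (in_ball d x r1) y); pose proof (indic_range (in_poly d H) y); nra. }
  intros r [Hr Hrr1]; destruct (Hex r Hr) as (I & HI).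
  set (l := r / r1).
  assert (Hl : 0 < l) by now apply Rdiv_lt_0_compat.
  assert (Hl1 : l <= 1) by (apply Rle_div_l; lra).
  assert (Hp : 0 < r ^ d) by now apply pow_lt.
  replace (I1 / (r1 ^ d * V) * (r ^ d * V)) with I; [assumption|].
  assert (E : I1 = I / l ^ d); [|rewrite E; unfold l, Rdiv; rewrite Rpow_mult_distr, pow_inv;
    field; lra].
  apply (has_int_unique d) with (1 := HI1).
  apply (has_int_ext d (fun y =>
    (fun y => indic (in_ball d x r) y * indic (in_poly d H) y)
      (fun i => l * y i + (1 - l) * x i)));
    [|exact (has_int_affine d l (fun i => (1 - l) * x i) _ _ Hl HI)].
  intros y; cbv beta.
  replace (fun i => l * y i + (1 - l) * x i) with (fun i => l * vsub y x i + x i)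
    by (apply functional_extensionality; intros; unfold vsub; ring).
  assert (Eb : in_ball d x r (fun i => l * vsub y x i + x i) <-> in_ball d x r1 y).
  { rewrite !in_ball_nrm by lra.
    replace (vsub (fun i => l * vsub y x i + x i) x) with (fun i => l * vsub y x i)
      by (apply functional_extensionality; intros; unfold vsub; ring).
    rewrite nrm_scal by lra; unfold l.
    replace (r / r1 * nrm d (vsub y x)) with (r * (nrm d (vsub y x) / r1)) by (field; lra).
    split; intros K.
    - assert (K' : nrm d (vsub y x) / r1 < 1) by nra.
      apply Rlt_div_l in K'; lra.
    - assert (K' : nrm d (vsub y x) / r1 < 1) by (apply Rlt_div_l; lra); nra. }
  destruct (excluded_middle_informative (in_ball d x r1 y)) as [Hin|Hout].
  - rewrite (indic_true (in_ball d x r)), (indic_true (in_ball d x r1)) by tauto.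
    f_equal; apply indic_iff; rewrite Hcone; [|now apply in_ball_nrm in Hin; [|lra]|lra].
    replace (fun i => vsub y x i + x i) with y
      by (apply functional_extensionality; intros; unfold vsub; ring); reflexivity.
  - rewrite (indic_false (in_ball d x r)), (indic_false (in_ball d x r1)) by tauto; ring.
Qed.

Lemma ball_bounded d c r y :
  in_ball d c r y -> 0 < r -> forall i, (i < d)%nat -> Rabs (y i) <= r + Rabs (c i).
Proof.
  intros Hy Hr i Hi; apply in_ball_nrm in Hy; [|lra].
  pose proof (Rabs_le_nrm d (vsub y c) i Hi) as K.
  replace (y i) with (vsub y c i + c i) by (unfold vsub; ring).
  eapply Rle_trans; [apply Rabs_triang|]; lra.
Qed.

Lemma supported_has_int_is_integral d f I M :
  supported d M f -> has_int d f I -> is_integral d f I.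
Proof.
  intros Hs Hf; destruct (INR_unbounded M) as (N & HN).
  apply has_int_is_integral with N; [|assumption].
  intros x Hx i Hi; specialize (Hs x Hx i Hi); lra.
Qed.

Lemma ball_supported d c r :
  0 < r -> supported d (r + sum_lt d (fun i => Rabs (c i))) (indic (in_ball d c r)).
Proof.
  intros Hr y Hy i Hi; apply indic_neq0 in Hy.
  eapply Rle_trans; [now apply (ball_bounded d c r)|].
  pose proof (sum_lt_ge_term d (fun i => Rabs (c i)) i (fun j _ => Rabs_pos _) Hi).
  simpl in *; lra.
Qed.

Lemma solid_angle_of_ratio d H V x r1 w :
  0 < V -> 0 < r1 ->
  (forall c r, 0 < r -> has_int d (indic (in_ball d c r)) (r ^ d * V)) ->
  (forall r, 0 < r <= r1 ->
    has_int d (fun y => indic (in_ball d x r) y * indic (in_poly d H) y) (w * (r ^ d * V))) ->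
  is_solid_angle d H x w.
Proof.
  intros HV Hr1 Hball Hcone e He; exists r1; split; [assumption|]; intros r Hr.
  pose proof (ball_supported d x r (proj1 Hr)) as Hs.
  exists (r ^ d * V), (w * (r ^ d * V)); repeat split.
  - eapply supported_has_int_is_integral; [exact Hs|apply Hball; lra].
  - eapply supported_has_int_is_integral with (M := r + sum_lt d (fun i => Rabs (x i))).
    + apply supported_le with (2 := Hs); intros y; rewrite indic_and.
      pose proof (indic_range (in_ball d x r) y); pose proof (indic_range (in_poly d H) y); nra.
    + apply (has_int_ext d (fun y => indic (in_ball d x r) y * indic (in_poly d H) y));
        [intros; now rewrite indic_and|apply Hcone; lra].
  - assert (0 < r ^ d) by (apply pow_lt; lra).
    replace (w * (r ^ d * V) / (r ^ d * V) - w) with 0 by (field; lra).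
    now rewrite Rabs_R0.
Qed.

(** * The Gaussian integral *)

Ltac real_eq := match goal with |- ?a = ?b => change (@eq R a b) end.

Definition gauss1 (t : R) : R := exp (- PI * (t * t)).

Lemma gauss1_continuous t : continuous gauss1 t.
Proof.
  apply (ex_derive_continuous (V := R_NormedModule)); unfold gauss1; auto_derive; auto.
Qed.

Lemma gauss1_ex_RInt a b : ex_RInt gauss1 a b.
Proof.
  apply (ex_RInt_continuous (V := R_CompleteNormedModule)); intros; apply gauss1_continuous.
Qed.

Lemma one_plus_sqr_pos t : 0 < 1 + t * t.
Proof. nra. Qed.

(** The auxiliary function in the classical evaluation of the Gaussian integral by differentiation
    under the integral sign, which dispenses with polar coordinates. *)
Definition gauss_aux (x : R) : R := RInt (fun t => exp (- PI * (x * x) * (1 + t * t)) / (1 + t * t)) 0 1.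

Lemma gauss_aux_integrand_derive (t x : R) :
  is_derive (fun u => exp (- PI * (u * u) * (1 + t * t)) / (1 + t * t)) x
            (- (2 * PI) * x * exp (- PI * (x * x) * (1 + t * t))).
Proof.
  pose proof (one_plus_sqr_pos t); auto_derive; [lra|field; lra].
Qed.

Lemma gauss_aux_ex_RInt x :
  ex_RInt (fun t => exp (- PI * (x * x) * (1 + t * t)) / (1 + t * t)) 0 1.
Proof.
  apply (ex_RInt_continuous (V := R_CompleteNormedModule)); intros t _.
  apply (ex_derive_continuous (V := R_NormedModule)); auto_derive.
  pose proof (one_plus_sqr_pos t); lra.
Qed.

(** Differentiating in [x] cancels the denominator [1 + t * t]; the factor [gauss1 x] comes out, and
    the substitution [u = x * t] turns the rest into the integral of [gauss1] over [[0, x]]. *)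
Lemma gauss_aux_derive (x : R) :
  is_derive gauss_aux x (- (2 * PI) * gauss1 x * RInt gauss1 0 x).
Proof.
  replace (- (2 * PI) * gauss1 x * RInt gauss1 0 x) with
    (RInt (fun t => Derive (fun u => exp (- PI * (u * u) * (1 + t * t)) / (1 + t * t)) x) 0 1).
  - apply (is_derive_RInt_param (fun x t => exp (- PI * (x * x) * (1 + t * t)) / (1 + t * t))).
    + apply filter_forall; intros u t _; eexists; apply gauss_aux_integrand_derive.
    + intros t _.
      apply continuity_2d_pt_ext with
        (f := fun u v => - (2 * PI) * u * exp (- PI * (u * u) * (1 + v * v))).
      * intros u v; symmetry; apply is_derive_unique, gauss_aux_integrand_derive.
      * repeat apply continuity_2d_pt_mult || apply continuity_2d_pt_id1 ||
          apply continuity_2d_pt_const.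
        apply (continuity_1d_2d_pt_comp exp).
        -- apply derivable_continuous_pt, derivable_pt_exp.
        -- apply continuity_2d_pt_mult; [apply continuity_2d_pt_mult;
             [apply continuity_2d_pt_const|apply continuity_2d_pt_mult; apply continuity_2d_pt_id1]
            |apply continuity_2d_pt_plus;
             [apply continuity_2d_pt_const|apply continuity_2d_pt_mult; apply continuity_2d_pt_id2]].
    + apply filter_forall; intros u; apply gauss_aux_ex_RInt.
  - pose proof (RInt_comp_lin gauss1 x 0 0 1 (gauss1_ex_RInt _ _)) as E.
    replace (x * 0 + 0) with 0 in E by ring; replace (x * 1 + 0) with x in E by ring.
    rewrite <- E.
    change (- (2 * PI) * gauss1 x * RInt (fun y => scal x (gauss1 (x * y + 0))) 0 1)
      with (scal (- (2 * PI) * gauss1 x) (RInt (fun y => scal x (gauss1 (x * y + 0))) 0 1)).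
    rewrite <- (RInt_scal (V := R_CompleteNormedModule)).
    + apply RInt_ext; intros t _.
      etransitivity; [apply is_derive_unique, gauss_aux_integrand_derive|].
      unfold scal; simpl; unfold mult; simpl; unfold gauss1.
      replace (- PI * (x * x) * (1 + t * t))
        with (- PI * (x * x) + - PI * ((x * t + 0) * (x * t + 0))) by ring.
      rewrite exp_plus; real_eq; ring.
    + apply (ex_RInt_comp_lin gauss1 x 0 0 1), gauss1_ex_RInt.
Qed.

Lemma gauss_aux_0 : gauss_aux 0 = PI / 4.
Proof.
  unfold gauss_aux.
  rewrite (RInt_ext _ (fun t => / (1 + t ^ 2))).
  - apply is_RInt_unique.
    replace (PI / 4) with (minus (atan 1) (atan 0)).
    + apply (is_RInt_derive (V := R_CompleteNormedModule)).
      * intros t _; apply is_derive_Reals, derivable_pt_lim_atan.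
      * intros t _; apply (ex_derive_continuous (V := R_NormedModule)); auto_derive.
        pose proof (one_plus_sqr_pos t); nra.
    + rewrite atan_1, atan_0; unfold minus, plus, opp; simpl; ring.
  - intros t _; replace (- PI * (0 * 0) * (1 + t * t)) with 0 by ring.
    rewrite exp_0; unfold Rdiv; rewrite Rmult_1_l; f_equal; ring.
Qed.

(* The parameter integral [gauss_aux] satisfies [gauss_aux' = - PI * (A^2)'] for
   [A x = RInt gauss1 0 x]. *)
Lemma gauss1_integral_sqr x : 0 < x ->
  RInt gauss1 0 x * RInt gauss1 0 x + gauss_aux x / PI = / 4.
Proof.
  intros Hx; pose proof PI_RGT_0 as Hpi.
  replace (/ 4) with (RInt gauss1 0 0 * RInt gauss1 0 0 + gauss_aux 0 / PI).
  2:{ rewrite RInt_point, gauss_aux_0; unfold zero; simpl; field; lra. }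
  symmetry.
  apply (eq_is_derive (V := R_NormedModule)
    (fun x => RInt gauss1 0 x * RInt gauss1 0 x + gauss_aux x / PI)); [|assumption].
  intros t _.
  assert (HA : is_derive (fun x => RInt gauss1 0 x) t (gauss1 t)).
  { apply (is_derive_RInt (V := R_NormedModule)) with (a := 0);
      [|apply gauss1_continuous].
    apply filter_forall; intros b; apply (RInt_correct (V := R_CompleteNormedModule)), gauss1_ex_RInt. }
  pose proof (gauss_aux_derive t) as HB.
  evar_last.
  - apply (is_derive_plus (V := R_NormedModule)).
    + apply (is_derive_mult (fun x => RInt gauss1 0 x) (fun x => RInt gauss1 0 x));
        [exact HA|exact HA|intros; apply Rmult_comm].
    + apply (is_derive_ext (fun x => scal (/ PI) (gauss_aux x))).
      * intros; unfold scal; simpl; unfold mult; simpl; unfold Rdiv; ring.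
      * apply is_derive_scal; exact HB.
  - unfold scal, plus, mult, zero; simpl; unfold mult; simpl; real_eq; field; lra.
Qed.

Lemma exp_le_compat u v : u <= v -> exp u <= exp v.
Proof. intros [H | ->]; [left; now apply exp_increasing|lra]. Qed.

Lemma exp_neg_le u : 0 <= u -> exp (- u) <= / (1 + u).
Proof.
  intros Hu; rewrite exp_Ropp; apply Rinv_le_contravar; [lra|].
  destruct (Req_dec u 0) as [->|]; [rewrite exp_0; lra|].
  left; apply exp_ineq1; lra.
Qed.

Lemma gauss_aux_bound x : 0 <= gauss_aux x <= / (1 + PI * (x * x)).
Proof.
  pose proof PI_RGT_0 as Hpi.
  assert (Hu : 0 <= PI * (x * x)) by nra.
  assert (Hint : forall t, 0 <= exp (- PI * (x * x) * (1 + t * t)) / (1 + t * t)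
                           <= / (1 + PI * (x * x))).
  { intros t; pose proof (one_plus_sqr_pos t).
    assert (He := exp_pos (- PI * (x * x) * (1 + t * t))).
    split; [apply Rlt_le, Rdiv_lt_0_compat; assumption|].
    apply Rle_trans with (exp (- PI * (x * x) * (1 + t * t))).
    - apply Rle_div_l; [assumption|]; nra.
    - eapply Rle_trans; [|apply exp_neg_le, Hu].
      apply exp_le_compat; nra. }
  split.
  - apply RInt_ge_0; [lra|apply gauss_aux_ex_RInt|intros; apply Hint].
  - eapply Rle_trans; [apply Rle_abs|].
    replace (/ (1 + PI * (x * x))) with ((1 - 0) * / (1 + PI * (x * x))) by ring.
    apply abs_RInt_le_const; [lra|apply gauss_aux_ex_RInt|].
    intros t _; rewrite Rabs_pos_eq; apply Hint.
Qed.

Lemma gauss1_pos t : 0 < gauss1 t.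
Proof. apply exp_pos. Qed.

Lemma gauss1_integral_sym a :
  RInt gauss1 (- a) a = 2 * RInt gauss1 0 a.
Proof.
  rewrite <- (RInt_Chasles gauss1 (- a) 0 a) by apply gauss1_ex_RInt.
  enough (E : RInt gauss1 (- a) 0 = RInt gauss1 0 a) by (rewrite E; unfold plus; simpl; ring).
  pose proof (RInt_comp_lin gauss1 (-1) 0 0 a (gauss1_ex_RInt _ _)) as E.
  replace (-1 * 0 + 0) with 0 in E by ring; replace (-1 * a + 0) with (- a) in E by ring.
  rewrite <- opp_RInt_swap by apply gauss1_ex_RInt; rewrite <- E.
  rewrite <- RInt_opp by apply (ex_RInt_comp_lin gauss1 (-1) 0), gauss1_ex_RInt.
  apply RInt_ext; intros t _; unfold opp, scal; simpl; unfold mult; simpl; unfold gauss1.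
  replace (- PI * ((-1 * t + 0) * (-1 * t + 0))) with (- PI * (t * t)) by ring; real_eq; ring.
Qed.

Lemma gauss1_integral_lim a : 1 <= a -> 1 - 2 / a <= RInt gauss1 (- a) a <= 1.
Proof.
  intros Ha; rewrite gauss1_integral_sym.
  pose proof PI_RGT_0 as Hpi; pose proof PI2_1 as Hpi2.
  pose proof (gauss1_integral_sqr a ltac:(lra)) as E.
  destruct (gauss_aux_bound a) as [B0 B1].
  assert (HA : 0 <= RInt gauss1 0 a).
  { apply RInt_ge_0; [lra|apply gauss1_ex_RInt|intros; apply Rlt_le, gauss1_pos]. }
  set (A := RInt gauss1 0 a) in *.
  assert (E1 : (2 * A) * (2 * A) = 1 - 4 / PI * gauss_aux a).
  { replace (2 * A * (2 * A)) with (4 * (A * A)) by ring.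
    replace (A * A) with (/ 4 - gauss_aux a / PI) by lra; field; lra. }
  assert (H4 : 0 <= 4 / PI * gauss_aux a <= 2 / a).
  { assert (0 < 4 / PI) by (apply Rdiv_lt_0_compat; lra).
    assert (4 / PI <= 2) by (apply Rle_div_l; lra).
    split; [nra|].
    apply Rle_trans with (2 * / (1 + PI * (a * a))); [nra|].
    apply Rmult_le_compat_l; [lra|]; apply Rinv_le_contravar; [lra|]; nra. }
  split; nra.
Qed.

(** * Gaussians in dimension [d] *)

Lemma exp_neg_range u : 0 <= u -> 0 <= exp (- u) <= 1.
Proof.
  intros Hu; split; [apply Rlt_le, exp_pos|].
  rewrite <- exp_0; apply exp_le_compat; lra.
Qed.

(** By the mean value theorem and [exp (- u) <= / (1 + u)], the slope is at most
    [|2 c x| / (1 + c x^2)], which [1 + c] dominates. The constant is not sharp; only its finiteness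
    matters. *)
Lemma exp_neg_sqr_lipschitz c t u :
  0 < c -> Rabs (exp (- (c * (t * t))) - exp (- (c * (u * u)))) <= (1 + c) * Rabs (t - u).
Proof.
  intros Hc.
  assert (Hd : forall x : R, is_derive (fun x => exp (- (c * (x * x)))) x
                                   (- (2 * c * x) * exp (- (c * (x * x))))).
  { intros x; auto_derive; [auto|ring]. }
  destruct (MVT_gen (fun x => exp (- (c * (x * x)))) u t
              (fun x => - (2 * c * x) * exp (- (c * (x * x))))) as (x & _ & E).
  - intros; apply Hd.
  - intros x _; apply continuity_pt_filterlim.
    apply (ex_derive_continuous (V := R_NormedModule) (fun x => exp (- (c * (x * x)))));
      eexists; exact (Hd x).
  - rewrite E, Rabs_mult; apply Rmult_le_compat_r; [apply Rabs_pos|].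
    rewrite Rabs_mult, Rabs_Ropp, (Rabs_pos_eq (exp _)) by apply Rlt_le, exp_pos.
    assert (H1 : exp (- (c * (x * x))) <= / (1 + c * (x * x))) by (apply exp_neg_le; nra).
    apply Rle_trans with (Rabs (2 * c * x) * / (1 + c * (x * x))).
    + apply Rmult_le_compat_l; [apply Rabs_pos|assumption].
    + assert (0 <= c * (x * x)) by nra.
      apply Rle_div_l; [lra|]; apply Rabs_le; split; nra.
Qed.

(** Exchanging one factor at a time costs [K * |x i - y i|], the other factors being at most 1; with
    the l1 distance the constant does not grow with [d]. *)
Lemma unit_lipschitz_prod d (phi : nat -> R -> R) K :
  0 <= K -> (forall i t, 0 <= phi i t <= 1) ->
  (forall i t u, Rabs (phi i t - phi i u) <= K * Rabs (t - u)) ->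
  unit_lipschitz d (fun x => prod_lt d (fun i => phi i (x i))).
Proof.
  intros HK H01 Hphi.
  assert (Hr : forall n x, 0 <= prod_lt n (fun i => phi i (x i)) <= 1).
  { induction n as [|n IH]; intros x; simpl; [lra|].
    specialize (IH x); specialize (H01 n (x n)); nra. }
  split; [apply Hr|]; exists K; split; [assumption|]; intros x y.
  unfold dist1; induction d as [|d IH]; simpl.
  - rewrite Rminus_diag, Rabs_R0; lra.
  - rewrite Rmult_plus_distr_l; apply Rabs_mult_minus_le; auto; try apply Hr.
Qed.

Lemma prod_lt_exp d c (z : vec) :
  prod_lt d (fun i => exp (- (c * (z i * z i)))) = exp (- (c * norm2 d z)).
Proof.
  unfold norm2; induction d as [|d IH]; simpl.
  - rewrite Rmult_0_r, Ropp_0, exp_0; reflexivity.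
  - rewrite IH, <- exp_plus; f_equal; ring.
Qed.

(** The Gaussian without its normalisation, so that it takes values in [[0, 1]]. With
    [c = PI / eps], division by [sqrt eps ^ d] restores the kernel ([gauss_bump]). *)
Definition bump (d : nat) (c : R) (x y : vec) : R := exp (- (c * norm2 d (vsub x y))).

Lemma bump_unit_lipschitz d c x : 0 < c -> unit_lipschitz d (bump d c x).
Proof.
  intros Hc.
  destruct (unit_lipschitz_prod d (fun i t => exp (- (c * ((x i - t) * (x i - t))))) (1 + c))
    as [H1 (L & HL & H2)].
  - lra.
  - intros; apply exp_neg_range; apply Rmult_le_pos; [lra|apply Rle_0_sqr].
  - intros i t u; eapply Rle_trans; [now apply exp_neg_sqr_lipschitz|].
    right; f_equal; rewrite <- Rabs_Ropp; f_equal; ring.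
  - assert (E : forall y, prod_lt d (fun i => exp (- (c * ((x i - y i) * (x i - y i)))))
                     = bump d c x y).
    { intros y; exact (prod_lt_exp d c (vsub x y)). }
    split; [intros y; rewrite <- E; apply H1|].
    exists L; split; [assumption|]; intros y z; rewrite <- !E; apply H2.
Qed.

(** A compactly supported Lipschitz minorant of [gauss1], equal to it on [[-a, a]], so that
    [has_int_prod] applies. *)
Definition cutoff (a t : R) : R := gauss1 t * clamp (a + 1 - Rabs t).

Lemma gauss1_range t : 0 <= gauss1 t <= 1.
Proof.
  unfold gauss1; replace (- PI * (t * t)) with (- (PI * (t * t))) by ring.
  apply exp_neg_range; pose proof PI_RGT_0; nra.
Qed.

Lemma cutoff_lipschitz a t u :
  Rabs (cutoff a t - cutoff a u) <= (2 + PI) * Rabs (t - u).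
Proof.
  replace ((2 + PI) * Rabs (t - u)) with ((1 + PI) * Rabs (t - u) + Rabs (t - u)) by ring.
  apply Rabs_mult_minus_le; [apply gauss1_range|apply clamp_range| |].
  - unfold gauss1; pose proof (exp_neg_sqr_lipschitz PI t u PI_RGT_0) as H.
    replace (- PI * (t * t)) with (- (PI * (t * t))) by ring.
    replace (- PI * (u * u)) with (- (PI * (u * u))) by ring; exact H.
  - eapply Rle_trans; [apply clamp_lipschitz|].
    replace (a + 1 - Rabs t - (a + 1 - Rabs u)) with (Rabs u - Rabs t) by ring.
    rewrite (Rabs_minus_sym t u); apply Rabs_triang_inv2.
Qed.

Lemma cutoff_supp a t : cutoff a t <> 0 -> Rabs t <= a + 1.
Proof.
  intros H; apply Rnot_lt_le; intros Hlt; apply H; unfold cutoff.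
  replace (clamp (a + 1 - Rabs t)) with 0 by clamp_cases; ring.
Qed.

Lemma cutoff_le a t : cutoff a t <= gauss1 t.
Proof.
  unfold cutoff; pose proof (gauss1_range t); pose proof (clamp_range (a + 1 - Rabs t)); nra.
Qed.

Lemma cutoff_eq a t : Rabs t <= a -> cutoff a t = gauss1 t.
Proof.
  intros Ht; unfold cutoff; replace (clamp (a + 1 - Rabs t)) with 1 by clamp_cases; ring.
Qed.

Lemma cutoff_integral a :
  1 <= a -> 1 - 2 / a <= RInt (cutoff a) (- (a + 1)) (a + 1) <= 1.
Proof.
  intros Ha.
  assert (Hex : forall u v, ex_RInt (cutoff a) u v).
  { apply (lipschitz_ex_RInt _ (2 + PI)); [pose proof PI_RGT_0; lra|apply cutoff_lipschitz]. }
  assert (Hpos : forall t, 0 <= cutoff a t).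
  { intros t; apply Rmult_le_pos; [apply gauss1_range|apply clamp_range]. }
  pose proof (gauss1_integral_lim a Ha) as [H1 _].
  pose proof (gauss1_integral_lim (a + 1) ltac:(lra)) as [_ H2].
  split.
  - eapply Rle_trans; [exact H1|].
    rewrite <- (RInt_Chasles (cutoff a) (- (a + 1)) (- a) (a + 1)) by apply Hex.
    rewrite <- (RInt_Chasles (cutoff a) (- a) a (a + 1)) by apply Hex.
    rewrite (RInt_ext gauss1 (cutoff a) (- a) a).
    + assert (0 <= RInt (cutoff a) (- (a + 1)) (- a)) by (apply RInt_ge_0; [lra|auto|auto]).
      assert (0 <= RInt (cutoff a) a (a + 1)) by (apply RInt_ge_0; [lra|auto|auto]).
      unfold plus; simpl; lra.
    + intros t Ht; rewrite Rmin_left, Rmax_right in Ht by lra.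
      symmetry; apply cutoff_eq, Rabs_le; lra.
  - eapply Rle_trans; [|exact H2].
    apply RInt_le; [lra|auto|apply gauss1_ex_RInt|intros; apply cutoff_le].
Qed.

Lemma cutoff_prod_has_int d a :
  0 <= a ->
  has_int d (fun x => prod_lt d (fun i => cutoff a (x i)))
            (RInt (cutoff a) (- (a + 1)) (a + 1) ^ d).
Proof.
  intros Ha; induction d as [|d IH].
  - apply (filterlim_ext (fun _ => 1)); [|apply filterlim_const].
    intros [[s v] N]; unfold gsum, riemann_sum; simpl; ring.
  - simpl pow; rewrite Rmult_comm.
    apply (has_int_prod d (fun x => prod_lt d (fun i => cutoff a (x i))) _ (cutoff a) (2 + PI)).
    + lra.
    + pose proof PI_RGT_0; lra.
    + apply cutoff_lipschitz.
    + apply cutoff_supp.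
    + intros x t; apply prod_lt_ext; intros i Hi; rewrite upd_other by lia; reflexivity.
    + exact IH.
Qed.

Lemma prod_lt_gauss1 d x : prod_lt d (fun i => gauss1 (x i)) = exp (- (PI * norm2 d x)).
Proof.
  rewrite <- prod_lt_exp; apply prod_lt_ext; intros; unfold gauss1; f_equal; ring.
Qed.

Lemma prod_lt_le d u v :
  (forall i, (i < d)%nat -> 0 <= u i <= v i) -> 0 <= prod_lt d u <= prod_lt d v.
Proof.
  induction d as [|d IH]; simpl; intros H; [lra|].
  assert (H1 : 0 <= prod_lt d u <= prod_lt d v) by (apply IH; auto).
  pose proof (H d ltac:(lia)); split; [apply Rmult_le_pos; lra|apply Rmult_le_compat; lra].
Qed.

Lemma cutoff_nonneg a t : 0 <= cutoff a t.
Proof. apply Rmult_le_pos; [apply gauss1_range|apply clamp_range]. Qed.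

Lemma prod_lt_neq0 d u i : prod_lt d u <> 0 -> (i < d)%nat -> u i <> 0.
Proof.
  induction d as [|d IH]; simpl; intros H Hi; [lia|].
  destruct (Nat.eq_dec i d) as [->|].
  - intros E; apply H; rewrite E; ring.
  - apply IH; [|lia]; intros E; apply H; rewrite E; ring.
Qed.

Lemma nrm_le_sum d x : nrm d x <= sum_lt d (fun i => Rabs (x i)).
Proof.
  destruct (nrm_lipschitz d) as [_ H]; specialize (H x (fun _ => 0)).
  replace (nrm d (fun _ => 0)) with 0 in H.
  - rewrite Rminus_0_r, (Rabs_pos_eq (nrm d x)), Rmult_1_l in H by apply nrm_nonneg.
    eapply Rle_trans; [exact H|right]; apply sum_lt_ext; intros; now rewrite Rminus_0_r.
  - transitivity (nrm d (fun i => 0 * (fun _ => 0) i)); [rewrite nrm_scal; lra|].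
    f_equal; apply functional_extensionality; intros; ring.
Qed.

Lemma sum_lt_const d c : sum_lt d (fun _ => c) = INR d * c.
Proof. induction d as [|d IH]; [simpl; ring|]; rewrite S_INR; simpl sum_lt; rewrite IH; ring. Qed.

(** A large ball lies between two cubes, on which the Gaussian integral is a product. From below the
    ball contains the support of the product of the [cutoff a]; from above the product of the
    [cutoff R] equals the Gaussian on the ball. *)
Lemma ball_gauss_mass d e : 0 < e -> exists R0, 0 < R0 /\ forall R W, R0 <= R ->
  has_int d (fun y => indic (in_ball d (fun _ => 0) R) y * exp (- (PI * norm2 d y))) W ->
  1 - e <= W <= 1.
Proof.
  intros He; pose proof (pos_INR d) as Hd.
  (* Chosen so that [INR d * (2 / a) <= e], which is the loss in [(1 - 2 / a) ^ d] by Bernoulli's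
     inequality. *)
  set (a := 2 + 2 * INR d / e).
  assert (Hq : 0 <= 2 * INR d / e) by (apply Rmult_le_pos; [lra|now apply Rlt_le, Rinv_0_lt_compat]).
  assert (Ha : 2 <= a) by (unfold a; lra).
  (* The Euclidean norm is at most the l1 norm, hence at most [INR d * (a + 1)] on the cube; the
     extra 1 gives strict inclusion. *)
  exists (INR d * (a + 1) + 1); split; [nra|]; intros R W HR HW.
  assert (HR1 : 1 <= R) by nra.
  assert (Hb0 : forall y : vec, vsub y (fun _ => 0) = y).
  { intros y; apply functional_extensionality; intros; unfold vsub; ring. }
  split.
  - apply Rle_trans with (RInt (cutoff a) (- (a + 1)) (a + 1) ^ d).
    + destruct (cutoff_integral a ltac:(lra)) as [H1 _].
      assert (Ha2 : 0 <= 2 / a <= 1).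
      { split; [apply Rlt_le, Rdiv_lt_0_compat; lra|apply Rle_div_l; lra]. }
      apply Rle_trans with ((1 - 2 / a) ^ d); [|apply pow_incr; lra].
      eapply Rle_trans; [|apply bernoulli_minus, Ha2].
      enough (INR d * (2 / a) <= e) by lra.
      replace (INR d * (2 / a)) with (2 * INR d / a) by (field; lra).
      apply Rle_div_l; [lra|]; unfold a.
      replace (e * (2 + 2 * INR d / e)) with (2 * e + 2 * INR d) by (field; lra); lra.
    + apply (has_int_le d) with (2 := cutoff_prod_has_int d a ltac:(lra)) (3 := HW).
      intros x; rewrite <- prod_lt_gauss1.
      destruct (Req_dec (prod_lt d (fun i => cutoff a (x i))) 0) as [->|N].
      * apply Rmult_le_pos; [apply indic_range|].
        rewrite prod_lt_gauss1; apply Rlt_le, exp_pos.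
      * rewrite indic_true.
        -- rewrite Rmult_1_l; apply prod_lt_le; intros; split;
             [apply cutoff_nonneg|apply cutoff_le].
        -- apply in_ball_nrm; [lra|]; rewrite Hb0.
           apply Rle_lt_trans with (INR d * (a + 1)); [|lra].
           eapply Rle_trans; [apply nrm_le_sum|]; rewrite <- sum_lt_const.
           apply sum_lt_le; intros i Hi; apply cutoff_supp.
           now apply (prod_lt_neq0 d (fun i => cutoff a (x i))).
  - apply Rle_trans with (RInt (cutoff R) (- (R + 1)) (R + 1) ^ d).
    + apply (has_int_le d) with (2 := HW) (3 := cutoff_prod_has_int d R ltac:(lra)).
      intros x; rewrite <- prod_lt_gauss1.
      destruct (excluded_middle_informative (in_ball d (fun _ => 0) R x)) as [Hin|Hout].
      * rewrite indic_true, Rmult_1_l by assumption; right; apply prod_lt_ext.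
        intros i Hi; symmetry; apply cutoff_eq.
        apply in_ball_nrm in Hin; [|lra]; rewrite Hb0 in Hin.
        pose proof (Rabs_le_nrm d x i Hi); lra.
      * rewrite indic_false, Rmult_0_l by assumption.
        apply (prod_lt_le d (fun i => cutoff R (x i)) (fun i => cutoff R (x i))).
        intros; split; [apply cutoff_nonneg|lra].
    + destruct (cutoff_integral R HR1) as [H1 H2].
      eapply Rle_trans; [apply pow_incr with (y := 1); split; [|assumption]|right; apply pow1].
      apply RInt_ge_0; [lra| |intros; apply cutoff_nonneg].
      apply (lipschitz_ex_RInt _ (2 + PI)); [pose proof PI_RGT_0; lra|apply cutoff_lipschitz].
Qed.

(** The profile [exp (- PI |y|^2)] is at most 1, so the volume of a large ball is at least its
    Gaussian mass, which exceeds a positive constant. *)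
Lemma ball_volume d :
  exists V, 0 < V /\ forall c r, 0 < r -> has_int d (indic (in_ball d c r)) (r ^ d * V).
Proof.
  destruct (ball_has_int d) as (V & HV); exists V; split; [|assumption].
  destruct (ball_gauss_mass d (1 / 2) ltac:(lra)) as (R & HR & HW).
  assert (HJ : jordan d (fun y => indic (in_ball d (fun _ => 0) R) y
                                  * bump d PI (fun _ => 0) y)).
  { apply jordan_mult_lipschitz; [now apply ball_jordan|].
    apply bump_unit_lipschitz, PI_RGT_0. }
  destruct (jordan_has_int _ _ HJ) as (W & HWi).
  assert (H1 : 1 - 1 / 2 <= W <= 1).
  { apply (HW R W (Rle_refl _)); revert HWi; apply has_int_ext; intros y.
    unfold bump; do 4 f_equal; apply sum_lt_ext; intros; unfold vsub; ring. }
  assert (H2 : W <= R ^ d * V).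
  { apply (has_int_le d) with (2 := HWi) (3 := HV (fun _ => 0) R HR); intros y.
    pose proof (indic_range (in_ball d (fun _ => 0) R) y).
    destruct (bump_unit_lipschitz d PI (fun _ => 0) PI_RGT_0) as [Hb _].
    specialize (Hb y); nra. }
  assert (0 < R ^ d) by now apply pow_lt.
  apply Rnot_le_lt; intros Hle; nra.
Qed.

Lemma ball_bump_has_int d eps x r W :
  0 < eps -> 0 < r ->
  has_int d (fun y => indic (in_ball d x r) y * bump d (PI / eps) x y) W ->
  has_int d (fun y => indic (in_ball d (fun _ => 0) (r / sqrt eps)) y * exp (- (PI * norm2 d y)))
    (W / sqrt eps ^ d).
Proof.
  intros He Hr HW.
  assert (Hs : 0 < sqrt eps) by now apply sqrt_lt_R0.
  assert (Hss : sqrt eps * sqrt eps = eps) by (apply sqrt_sqrt; lra).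
  pose proof (has_int_affine d (sqrt eps) x _ _ Hs HW) as H; revert H.
  apply has_int_ext; intros y.
  assert (E : vsub (fun i => sqrt eps * y i + x i) x = (fun i => sqrt eps * y i))
    by (apply functional_extensionality; intros; unfold vsub; ring).
  f_equal.
  - apply indic_iff; rewrite !in_ball_nrm by (try apply Rlt_le, Rdiv_lt_0_compat; lra).
    rewrite E, nrm_scal by lra.
    replace (vsub y (fun _ => 0)) with y
      by (apply functional_extensionality; intros; unfold vsub; ring).
    rewrite <- (Rlt_div_r (nrm d y) r (sqrt eps) Hs), Rmult_comm; reflexivity.
  - unfold bump; do 2 f_equal.
    replace (norm2 d (vsub x (fun i => sqrt eps * y i + x i)))
      with (sqrt eps * sqrt eps * norm2 d y); [rewrite Hss; field; lra|].
    rewrite <- norm2_scal; apply sum_lt_ext; intros; unfold vsub; ring.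
Qed.

(** * Radial integrands on cones *)

(** A choice function, meaningful only where an integral exists; it makes integrals into functions
    of a radius or of [eps]. *)
Definition integral (d : nat) (f : vec -> R) : R := epsilon (inhabits 0) (has_int d f).

Lemma jordan_integral d f : jordan d f -> has_int d f (integral d f).
Proof. intros Hf; unfold integral; apply epsilon_spec, jordan_has_int, Hf. Qed.

Lemma jordan_zero d : jordan d (fun _ => 0).
Proof.
  assert (H : unit_lipschitz d (fun _ => 0)).
  { split; [intros; lra|]; exists 0; split; [lra|]; intros.
    rewrite Rminus_diag, Rabs_R0; lra. }
  intros e He; exists (fun _ => 0), (fun _ => 0), 0, 0.
  repeat (split; [first [assumption | intros; lra | intros x Hx; lra]|]).
  split; [|lra].
  apply has_int_ext with (2 := has_int_zero d); intros; ring.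
Qed.

Lemma indic_ball_0 d x : indic (in_ball d x 0) = fun _ => 0.
Proof.
  apply functional_extensionality; intros y; apply indic_false; unfold in_ball.
  pose proof (norm2_nonneg d (vsub y x)); lra.
Qed.

(** Cut [[0, T]] into [n + 1] equal steps: each increment is at most [C * T / (n + 1)] times that of
    [V], and the increments of [V] telescope. The total is of order [1 / (n + 1)], without any
    continuity or differentiability. *)
Lemma eq_of_small_increments (psi V : R -> R) T C :
  0 <= T -> 0 <= C ->
  (forall s t, 0 <= s <= t -> t <= T -> Rabs (psi t - psi s) <= C * (t - s) * (V t - V s)) ->
  psi T = psi 0.
Proof.
  intros HT HC Hinc.
  assert (Hn : forall n : nat, Rabs (psi T - psi 0) <= C * T * (V T - V 0) * / INR (S n)).
  { intros n; assert (HSn : 0 < INR (S n)) by apply lt_0_INR, Nat.lt_0_succ.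
    set (h := T / INR (S n)).
    assert (Hh : 0 <= h) by (apply Rmult_le_pos; [assumption|now apply Rlt_le, Rinv_0_lt_compat]).
    assert (Hk : forall k, (k <= S n)%nat ->
      Rabs (psi (INR k * h) - psi 0) <= C * h * (V (INR k * h) - V 0)).
    { induction k as [|k IH]; intros Hk.
      - simpl INR; rewrite Rmult_0_l, !Rminus_diag, Rabs_R0; lra.
      - replace (psi (INR (S k) * h) - psi 0)
          with ((psi (INR (S k) * h) - psi (INR k * h)) + (psi (INR k * h) - psi 0)) by ring.
        eapply Rle_trans; [apply Rabs_triang|].
        assert (Hle : INR (S k) * h <= T).
        { replace T with (INR (S n) * h) by (unfold h; field; lra).
          apply Rmult_le_compat_r; [assumption|apply le_INR; lia]. }
        assert (Hk0 : 0 <= INR k * h) by (apply Rmult_le_pos; [apply pos_INR|assumption]).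
        specialize (IH ltac:(lia)).
        assert (Hs : INR (S k) * h = INR k * h + h) by (rewrite S_INR; ring).
        pose proof (Hinc (INR k * h) (INR (S k) * h) ltac:(lra) Hle) as H1.
        replace (INR (S k) * h - INR k * h) with h in H1 by lra; lra. }
    specialize (Hk (S n) (Nat.le_refl _)).
    replace (INR (S n) * h) with T in Hk by (unfold h; field; lra).
    eapply Rle_trans; [exact Hk|right; unfold h, Rdiv; ring]. }
  apply cond_eq; intros e He.
  set (B := C * T * (V T - V 0)) in *.
  destruct (archimed_cor1 (e / (Rabs B + 1))) as (n & Hn1 & Hn2).
  { apply Rdiv_lt_0_compat; [assumption|pose proof (Rabs_pos B); lra]. }
  destruct n as [|n]; [lia|]; specialize (Hn n).
  assert (Hi : 0 < / INR (S n)) by (apply Rinv_0_lt_compat, lt_0_INR; lia).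
  pose proof (Rle_abs B); pose proof (Rabs_pos B).
  apply (Rlt_div_r _ e) in Hn1; [|lra]; nra.
Qed.

Lemma exp_neg_lipschitz u v : 0 <= u <= v -> 0 <= exp (- u) - exp (- v) <= v - u.
Proof.
  intros Huv.
  assert (H1 : exp (- v) <= exp (- u)) by (apply exp_le_compat; lra).
  assert (H2 : exp (- v) = exp (- u) * exp (- (v - u))).
  { rewrite <- exp_plus; f_equal; ring. }
  destruct (exp_neg_range u) as [H3 H4]; [lra|].
  assert (H5 : 1 - (v - u) <= exp (- (v - u))).
  { pose proof (exp_ineq1_le (- (v - u))); lra. }
  split; [lra|]; rewrite H2; nra.
Qed.

Lemma bump_sym_nrm d c x y : bump d c x y = exp (- (c * (nrm d (vsub y x) * nrm d (vsub y x)))).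
Proof.
  unfold bump; rewrite nrm_sqr; do 3 f_equal; apply sum_lt_ext; intros; unfold vsub; ring.
Qed.

(* On a thin shell the Gaussian is nearly constant, so both integrals grow in the
   ratio [w]; the error is quadratically small in the thickness of the shell. *)
Lemma radial_ratio d c x r1 w (p : vec -> R) a b :
  0 < c -> 0 < r1 -> 0 <= w -> jordan d p ->
  (forall r, 0 < r <= r1 -> forall v, has_int d (indic (in_ball d x r)) v ->
     has_int d (fun y => indic (in_ball d x r) y * p y) (w * v)) ->
  has_int d (fun y => indic (in_ball d x r1) y * p y * bump d c x y) a ->
  has_int d (fun y => indic (in_ball d x r1) y * bump d c x y) b ->
  a = w * b.
Proof.
  intros Hc Hr1 Hw Hp Hcone Ha Hb.
  set (B := fun r => indic (in_ball d x r)).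
  assert (HJ : forall r, 0 <= r -> jordan d (B r)).
  { intros r [Hr|<-]; [now apply ball_jordan|]; unfold B; rewrite indic_ball_0.
    apply jordan_zero. }
  pose proof (bump_unit_lipschitz d c x Hc) as HG; pose proof (proj1 HG) as HG01.
  set (vol := fun r => integral d (B r)).
  set (I1 := fun r => integral d (fun y => B r y * p y * bump d c x y)).
  set (I2 := fun r => integral d (fun y => B r y * bump d c x y)).
  assert (Hvol : forall r, 0 <= r -> has_int d (B r) (vol r)).
  { intros; now apply jordan_integral, HJ. }
  assert (HI1 : forall r, 0 <= r -> has_int d (fun y => B r y * p y * bump d c x y) (I1 r)).
  { intros; apply jordan_integral, (jordan_mult_lipschitz d (fun y => B r y * p y)); [|assumption].
    apply jordan_mult; auto. }
  assert (HI2 : forall r, 0 <= r -> has_int d (fun y => B r y * bump d c x y) (I2 r)).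
  { intros; apply jordan_integral, jordan_mult_lipschitz; auto. }
  assert (Hvolp : forall r, 0 <= r <= r1 -> has_int d (fun y => B r y * p y) (w * vol r)).
  { intros r [[Hr|<-] Hrr]; [apply Hcone; [lra|apply Hvol; lra]|].
    pose proof (Hvol 0 (Rle_refl 0)) as H; unfold B in *; rewrite indic_ball_0 in *.
    rewrite (has_int_unique _ _ _ _ H (has_int_zero d)).
    apply has_int_ext with (f := fun _ => 0); [intros; ring|].
    rewrite Rmult_0_r; apply has_int_zero. }
  assert (E1 : a = I1 r1) by (apply (has_int_unique _ _ _ _ Ha), HI1; lra).
  assert (E2 : b = I2 r1) by (apply (has_int_unique _ _ _ _ Hb), HI2; lra).
  assert (Z1 : I1 0 = 0).
  { apply (has_int_unique _ _ _ _ (HI1 0 (Rle_refl 0))).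
    unfold B; rewrite indic_ball_0; apply has_int_ext with (2 := has_int_zero d); intros; ring. }
  assert (Z2 : I2 0 = 0).
  { apply (has_int_unique _ _ _ _ (HI2 0 (Rle_refl 0))).
    unfold B; rewrite indic_ball_0; apply has_int_ext with (2 := has_int_zero d); intros; ring. }
  enough (H : I1 r1 - w * I2 r1 = I1 0 - w * I2 0) by (rewrite E1, E2; rewrite Z1, Z2 in H; lra).
  (* The constant comes from [exp (- c s^2) - exp (- c t^2) <= c * (t^2 - s^2) <= 2 * c * r1 * (t -
     s)], times the weight [w]. *)
  apply (eq_of_small_increments (fun r => I1 r - w * I2 r) vol r1 (2 * c * r1 * w));
    [lra|repeat apply Rmult_le_pos; lra|].
  intros s t Hst Ht.
  set (E := fun r => exp (- (c * (r * r)))).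
  assert (Hshell : forall y, 0 <= B t y - B s y /\
     E t * (B t y - B s y) <= (B t y - B s y) * bump d c x y <= E s * (B t y - B s y)).
  { intros y; unfold B.
    destruct (excluded_middle_informative (in_ball d x s y)) as [Hs|Hs].
    - assert (Ht' : in_ball d x t y).
      { apply in_ball_nrm; [lra|]; apply in_ball_nrm in Hs; lra. }
      rewrite !indic_true by assumption; lra.
    - rewrite (indic_false (in_ball d x s)) by assumption.
      destruct (excluded_middle_informative (in_ball d x t y)) as [Hin|Hin].
      + rewrite indic_true by assumption; split; [lra|].
        apply in_ball_nrm in Hin; [|lra]; rewrite in_ball_nrm in Hs by lra.
        apply Rnot_lt_le in Hs; rewrite bump_sym_nrm.
        pose proof (nrm_nonneg d (vsub y x)).
        rewrite Rminus_0_r, !Rmult_1_r, Rmult_1_l; unfold E.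
        split; apply exp_le_compat, Ropp_le_contravar, Rmult_le_compat_l;
          solve [lra | apply Rmult_le_compat; lra].
      + rewrite indic_false by assumption; lra. }
  assert (Hp01 : forall y, 0 <= p y <= 1) by (intros; now apply (jordan_range d)).
  assert (Hs0 : 0 <= s) by lra.
  assert (Ht0 : 0 <= t) by lra.
  pose proof (has_int_minus _ _ _ _ _ (Hvol t Ht0) (Hvol s Hs0)) as D0.
  pose proof (has_int_minus _ _ _ _ _ (Hvolp t ltac:(lra)) (Hvolp s ltac:(lra))) as D1.
  pose proof (has_int_minus _ _ _ _ _ (HI1 t Ht0) (HI1 s Hs0)) as D2.
  pose proof (has_int_minus _ _ _ _ _ (HI2 t Ht0) (HI2 s Hs0)) as D3.
  assert (Hv : 0 <= vol t - vol s).
  { apply (has_int_nonneg d) with (2 := D0); intros y; apply Hshell. }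
  assert (L2 : E t * (w * vol t - w * vol s) <= I1 t - I1 s).
  { apply (has_int_le d) with (2 := has_int_scal d (E t) _ _ D1) (3 := D2); intros y.
    destruct (Hshell y) as (H1 & H2 & H3); specialize (Hp01 y); nra. }
  assert (U2 : I1 t - I1 s <= E s * (w * vol t - w * vol s)).
  { apply (has_int_le d) with (2 := D2) (3 := has_int_scal d (E s) _ _ D1); intros y.
    destruct (Hshell y) as (H1 & H2 & H3); specialize (Hp01 y); nra. }
  assert (L3 : E t * (vol t - vol s) <= I2 t - I2 s).
  { apply (has_int_le d) with (2 := has_int_scal d (E t) _ _ D0) (3 := D3); intros y.
    destruct (Hshell y) as (H1 & H2 & H3); nra. }
  assert (U3 : I2 t - I2 s <= E s * (vol t - vol s)).
  { apply (has_int_le d) with (2 := D3) (3 := has_int_scal d (E s) _ _ D0); intros y.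
    destruct (Hshell y) as (H1 & H2 & H3); nra. }
  apply (Rmult_le_compat_l w) in L3, U3; try assumption.
  assert (HE : E s - E t <= 2 * c * r1 * (t - s)).
  { destruct (exp_neg_lipschitz (c * (s * s)) (c * (t * t))) as [_ H].
    - split; [apply Rmult_le_pos; nra|apply Rmult_le_compat_l; nra].
    - unfold E; eapply Rle_trans; [exact H|].
      replace (c * (t * t) - c * (s * s)) with (c * (t - s) * (t + s)) by ring.
      assert (0 <= c * (t - s)) by nra; nra. }
  (* The increments of [I1] and of [w * I2] both lie between [E t] and [E s] times
     [w * (vol t - vol s)], so they differ by at most the length of that interval. *)
  apply Rle_trans with ((E s - E t) * (w * (vol t - vol s))).
  - apply Rabs_le; split; lra.
  - replace (2 * c * r1 * w * (t - s) * (vol t - vol s))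
      with (2 * c * r1 * (t - s) * (w * (vol t - vol s))) by ring.
    apply Rmult_le_compat_r; [nra|assumption].
Qed.

(** * Pointwise convergence and tails *)

(** From [exp u >= (u / (d + 1)) ^ (d + 1)] the exponential is of order [eps ^ (d + 1)], while
    [/ sqrt eps ^ d <= / eps ^ d] because [eps <= 1]; one factor [eps] is left. *)
Lemma exp_decay d alpha : 0 < alpha -> exists C, 0 <= C /\ forall eps, 0 < eps <= 1 ->
  exp (- (alpha / eps)) / sqrt eps ^ d <= C * eps.
Proof.
  intros Ha; set (b := alpha / INR (S d)).
  assert (HSd : 0 < INR (S d)) by apply lt_0_INR, Nat.lt_0_succ.
  assert (Hb : 0 < b) by now apply Rdiv_lt_0_compat.
  exists (/ b ^ S d); split; [apply Rlt_le, Rinv_0_lt_compat, pow_lt, Hb|].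
  intros eps He.
  assert (Hs : 0 < sqrt eps) by (apply sqrt_lt_R0; lra).
  assert (Hse : eps <= sqrt eps).
  { rewrite <- (sqrt_sqrt eps) at 1 by lra.
    assert (sqrt eps <= 1) by (rewrite <- sqrt_1; apply sqrt_le_1_alt; lra); nra. }
  assert (Hq : 0 < b / eps) by (apply Rdiv_lt_0_compat; lra).
  assert (H1 : exp (- (alpha / eps)) <= / (b / eps) ^ S d).
  { rewrite exp_Ropp; apply Rinv_le_contravar; [now apply pow_lt|].
    replace (alpha / eps) with (INR (S d) * (b / eps)) by (unfold b; field; lra).
    rewrite <- Rpower_pow by assumption; unfold Rpower; apply exp_le_compat.
    apply Rmult_le_compat_l; [lra|].
    rewrite <- (ln_exp (b / eps)) at 2; apply ln_le; [assumption|].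
    pose proof (exp_ineq1_le (b / eps)); lra. }
  assert (H2 : / sqrt eps ^ d <= / eps ^ d).
  { apply Rinv_le_contravar; [apply pow_lt; lra|apply pow_incr; lra]. }
  apply Rle_trans with (/ (b / eps) ^ S d * / eps ^ d).
  - apply Rmult_le_compat; [apply Rlt_le, exp_pos| |assumption|assumption].
    now apply Rlt_le, Rinv_0_lt_compat, pow_lt.
  - right; unfold Rdiv; rewrite Rpow_mult_distr, pow_inv; simpl pow.
    assert (0 < b ^ d) by (apply pow_lt; lra); assert (0 < eps ^ d) by (apply pow_lt; lra).
    field; repeat split; lra.
Qed.

(** One [w] serves both conclusions, which identifies the limit with the solid angle. The error is
    the far part of the polytope plus [w] times the Gaussian mass missing from the ball; each is
    kept below [e / 2]. *)
Lemma conv_pointwise d H x :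
  full_dim_polytope d H ->
  exists w, is_solid_angle d H x w /\
    forall e, 0 < e -> exists delta, 0 < delta /\ forall eps C, 0 < eps < delta ->
      has_int d (fun y => indic (in_poly d H) y * bump d (PI / eps) x y) C ->
      Rabs (C / sqrt eps ^ d - w) <= e.
Proof.
  intros HP; pose proof PI_RGT_0 as Hpi.
  destruct (ball_volume d) as (V & HV & Hball).
  destruct (ball_poly_has_int d H V x HP HV Hball) as (r & w & Hr & Hw & Hcone).
  exists w; split; [now apply (solid_angle_of_ratio d H V x r w)|].
  pose proof (poly_jordan d H HP) as HJ.
  destruct (jordan_has_int d _ HJ) as (VP & HVP).
  assert (HVP0 : 0 <= VP).
  { apply (has_int_nonneg d) with (2 := HVP); intros; apply indic_range. }
  intros e He.
  assert (He1 : 0 < e / (2 * (w + 1))) by (apply Rdiv_lt_0_compat; lra).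
  destruct (ball_gauss_mass d _ He1) as (R0 & HR0 & HW).
  assert (Ha : 0 < PI * (r * r)) by (apply Rmult_lt_0_compat; [|apply Rmult_lt_0_compat]; lra).
  destruct (exp_decay d _ Ha) as (D & HD & Hdec).
  assert (HVD : 0 <= VP * D) by now apply Rmult_le_pos.
  set (q := r / R0).
  assert (Hq : 0 < q) by now apply Rdiv_lt_0_compat.
  (* The bound 1 is required by [exp_decay]; [q * q] ensures [r / sqrt eps >= R0], so the rescaled
     ball carries nearly all the mass; the last bound makes the far part at most [e / 2]. *)
  exists (Rmin 1 (Rmin (q * q) (e / (2 * (VP * D + 1))))); split.
  { repeat apply Rmin_glb_lt; [lra|nra|apply Rdiv_lt_0_compat; lra]. }
  intros eps C [Heps Hlt] HC.
  apply Rmin_Rgt_l in Hlt as [Hlt1 Hlt]; apply Rmin_Rgt_l in Hlt as [Hlt2 Hlt3].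
  assert (Hs : 0 < sqrt eps) by now apply sqrt_lt_R0.
  assert (Hsd : 0 < sqrt eps ^ d) by now apply pow_lt.
  assert (Hc : 0 < PI / eps) by now apply Rdiv_lt_0_compat.
  pose proof (bump_unit_lipschitz d (PI / eps) x Hc) as HG.
  pose proof (ball_jordan d x r Hr) as HB.
  pose proof (jordan_integral d _ (jordan_mult_lipschitz d _ _ HB HG)) as Hb.
  pose proof (jordan_integral d _ (jordan_mult_lipschitz d _ _ (jordan_mult d _ _ HB HJ) HG)) as Hab.
  set (b := integral d _) in Hb; set (a := integral d _) in Hab.
  assert (Eab : a = w * b).
  { apply (radial_ratio d (PI / eps) x r w (indic (in_poly d H))); auto.
    intros s Hsr v Hv; rewrite (has_int_unique _ _ _ _ Hv (Hball x s (proj1 Hsr))).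
    now apply Hcone. }
  assert (HWb : 1 - e / (2 * (w + 1)) <= b / sqrt eps ^ d <= 1).
  { apply (HW (r / sqrt eps)).
    - apply Rle_div_r; [assumption|].
      assert (sqrt eps <= q).
      { rewrite <- (sqrt_square q) by lra; apply sqrt_le_1_alt; lra. }
      replace r with (R0 * q) by (unfold q; field; lra); nra.
    - now apply (ball_bump_has_int d eps x r). }
  assert (Hfar : 0 <= C - a <= VP * exp (- (PI * (r * r) / eps))).
  { pose proof (has_int_minus _ _ _ _ _ HC Hab) as Hd; split.
    - apply (has_int_nonneg d) with (2 := Hd); intros y.
      pose proof (indic_range (in_ball d x r) y); pose proof (indic_range (in_poly d H) y).
      destruct HG as [HG _]; specialize (HG y).
      assert (0 <= indic (in_poly d H) y * bump d (PI / eps) x y) by nra; nra.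
    - rewrite Rmult_comm.
      apply (has_int_le d) with (2 := Hd) (3 := has_int_scal d _ _ _ HVP); intros y.
      pose proof (indic_range (in_poly d H) y).
      assert (Hex : 0 < exp (- (PI * (r * r) / eps))) by apply exp_pos.
      destruct (excluded_middle_informative (in_ball d x r y)) as [Hin|Hin].
      + rewrite (indic_true (in_ball d x r)) by assumption; nra.
      + rewrite (indic_false (in_ball d x r)) by assumption.
        rewrite in_ball_nrm in Hin by lra; apply Rnot_lt_le in Hin.
        assert (bump d (PI / eps) x y <= exp (- (PI * (r * r) / eps))); [|nra].
        rewrite bump_sym_nrm; apply exp_le_compat, Ropp_le_contravar.
        replace (PI * (r * r) / eps) with (PI / eps * (r * r)) by (field; lra).
        apply Rmult_le_compat_l; [lra|nra]. }
  specialize (Hdec eps ltac:(lra)).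
  replace (C / sqrt eps ^ d - w)
    with ((C - a) / sqrt eps ^ d + w * (b / sqrt eps ^ d - 1))
    by (rewrite Eab; field; lra).
  assert (H1 : 0 <= (C - a) / sqrt eps ^ d <= e / 2).
  { split; [apply Rmult_le_pos; [lra|now apply Rlt_le, Rinv_0_lt_compat]|].
    apply Rle_trans with (VP * (exp (- (PI * (r * r) / eps)) / sqrt eps ^ d)).
    - set (z := exp (- (PI * (r * r) / eps))) in *.
      replace (VP * (z / sqrt eps ^ d)) with (VP * z / sqrt eps ^ d) by (unfold Rdiv; ring).
      apply Rmult_le_compat_r; [now apply Rlt_le, Rinv_0_lt_compat|lra].
    - apply Rle_trans with (VP * (D * eps)); [now apply Rmult_le_compat_l|].
      apply (Rlt_div_r eps e) in Hlt3; [|lra]; nra. }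
  assert (H2 : - (e / 2) <= w * (b / sqrt eps ^ d - 1) <= 0).
  { assert (w * (e / (2 * (w + 1))) <= e / 2); [|nra].
    replace (w * (e / (2 * (w + 1)))) with (e / 2 * (w / (w + 1))) by (field; lra).
    assert (w / (w + 1) <= 1) by (apply Rle_div_l; lra); nra. }
  apply Rabs_le; lra.
Qed.

Lemma gauss_bump d eps x y :
  0 < eps -> gauss d eps (vsub x y) = / sqrt eps ^ d * bump d (PI / eps) x y.
Proof.
  intros He; unfold gauss, bump; f_equal.
  - rewrite <- Rpower_pow by now apply sqrt_lt_R0.
    rewrite <- Rpower_sqrt, Rpower_mult, <- Rpower_Ropp by assumption; f_equal; field.
  - f_equal; field; lra.
Qed.

(** * Tails of the lattice sum *)

Definition excess (K : nat) (k : Z) : R := IZR (Z.max 0 (Z.abs k - Z.of_nat K)).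

Lemma excess_nonneg K k : 0 <= excess K k.
Proof. apply IZR_le; lia. Qed.

(** The excess is an integer, 0 or at least 1, hence at most its own square. This trades the
    quadratic exponent for a linear one, whose sum is geometric. *)
Lemma excess_sqr_le K k t :
  Rabs t <= INR K -> excess K k <= (IZR k - t) * (IZR k - t).
Proof.
  intros Ht; unfold excess.
  destruct (Z.le_gt_cases (Z.abs k - Z.of_nat K) 0) as [Hle|Hgt].
  - rewrite Z.max_l by lia; apply Rle_0_sqr.
  - rewrite Z.max_r by lia; set (m := (Z.abs k - Z.of_nat K)%Z) in *.
    assert (Hm1 : 1 <= IZR m) by (apply IZR_le; lia).
    assert (Hm : IZR m <= Rabs (IZR k - t)).
    { unfold m; rewrite minus_IZR, abs_IZR, <- INR_IZR_INZ.
      pose proof (Rabs_triang_inv (IZR k) t); lra. }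
    change (IZR m <= Rsqr (IZR k - t)); rewrite Rsqr_abs; unfold Rsqr; nra.
Qed.

(** Let [q] be the total excess, [q >= 1] outside the box. Since [PI / eps >= 1],
    [(PI / eps) * q >= PI / eps - 1 + q]. The bound thus splits into a factor small with [eps] and a
    summable factor free of [eps]. *)
Lemma conv_tail d H K VP eps (k : zvec) C :
  (forall y, in_poly d H y -> forall i, (i < d)%nat -> Rabs (y i) <= INR K) ->
  has_int d (indic (in_poly d H)) VP ->
  0 < eps <= 1 ->
  (exists i, (i < d)%nat /\ (Z.of_nat K < Z.abs (k i))%Z) ->
  has_int d (fun y => indic (in_poly d H) y * bump d (PI / eps) (ofZ k) y) C ->
  C <= VP * exp (1 - PI / eps) * prod_lt d (fun i => exp (- excess K (k i))).
Proof.
  intros HK HVP Heps (i0 & Hi0 & Hk) HC.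
  assert (Hpi : 1 <= PI) by (pose proof PI2_1; lra).
  assert (Hc : 1 <= PI / eps) by (apply Rle_div_r; lra).
  assert (Eprod : prod_lt d (fun i => exp (- excess K (k i)))
                  = exp (- sum_lt d (fun i => excess K (k i)))).
  { clear; induction d as [|d IH]; simpl; [now rewrite Ropp_0, exp_0|].
    rewrite IH, <- exp_plus; f_equal; ring. }
  rewrite Eprod, Rmult_assoc, <- exp_plus, Rmult_comm.
  set (q := sum_lt d (fun i => excess K (k i))).
  assert (Hq : 1 <= q).
  { apply Rle_trans with (excess K (k i0)); [apply IZR_le; lia|].
    apply (sum_lt_ge_term d (fun i => excess K (k i))); [|assumption].
    intros; apply excess_nonneg. }
  apply (has_int_le d) with (2 := HC) (3 := has_int_scal d _ _ _ HVP); intros y.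
  destruct (excluded_middle_informative (in_poly d H y)) as [Hy|Hy].
  - rewrite !indic_true by assumption; rewrite Rmult_1_l, Rmult_1_r.
    unfold bump; apply exp_le_compat.
    assert (Hn : q <= norm2 d (vsub (ofZ k) y)).
    { apply sum_lt_le; intros i Hi; apply excess_sqr_le; auto. }
    nra.
  - rewrite !indic_false by assumption; lra.
Qed.

Lemma exp_excess_sum K : exists T, forall N,
  lsum (fun k => exp (- excess K k)) (zrange N) <= T.
Proof.
  set (s := fun N => lsum (fun k => exp (- excess K k)) (zrange N)).
  exists (s K + 2).
  assert (Hmono : forall m n, (m <= n)%nat -> s m <= s n).
  { intros m n Hmn; induction Hmn as [|n Hmn IH]; [lra|].
    eapply Rle_trans; [exact IH|]; apply lsum_zrange_mono.
    intros; apply Rlt_le, exp_pos. }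
  (* The extra term [2 * exp (- INR j)] dominates what is still to come: the next layer adds two
     terms [exp (- INR (S j))], and [exp 1 >= 2] lets the invariant pay for them. *)
  assert (Hs : forall j, s (K + j)%nat + 2 * exp (- INR j) <= s K + 2).
  { induction j as [|j IH].
    - rewrite Nat.add_0_r; simpl INR; rewrite Ropp_0, exp_0; lra.
    - rewrite Nat.add_succ_r; unfold s at 1; rewrite lsum_zrange_S.
      fold (s (K + j)%nat).
      assert (Ee : forall k, Z.abs k = Z.of_nat (S (K + j)) -> excess K k = INR (S j)).
      { intros k E; unfold excess; rewrite E, Z.max_r, INR_IZR_INZ by lia; f_equal; lia. }
      rewrite !Ee by lia.
      assert (H2 : 2 * exp (- INR (S j)) <= exp (- INR j)); [|lra].
      replace (- INR j) with (1 + - INR (S j)) by (rewrite S_INR; ring).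
      rewrite exp_plus; apply Rmult_le_compat_r; [apply Rlt_le, exp_pos|].
      pose proof (exp_ineq1_le 1); lra. }
  intros N; fold (s N); destruct (Nat.le_ge_cases N K) as [HN|HN].
  - apply Hmono in HN; lra.
  - replace N with (K + (N - K))%nat by lia.
    specialize (Hs (N - K)%nat); pose proof (exp_pos (- INR (N - K))); lra.
Qed.

Lemma lattice_sum_tail d K (F u : zvec -> R) c T :
  0 <= c -> (forall k, 0 <= F k) -> (forall k, 0 <= u k) ->
  (forall k, (exists i, (i < d)%nat /\ (Z.of_nat K < Z.abs (k i))%Z) -> F k <= c * u k) ->
  (forall N, lsum u (box d N) <= T) ->
  exists S, is_lattice_sum d F S /\ 0 <= S - lsum F (box d K) <= c * T.
Proof.
  intros Hc HF Hu Hout HT.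
  set (s := fun N => lsum F (box d N)).
  assert (Hgrow : Un_growing s) by (intros N; now apply lsum_box_mono).
  set (inside := fun k : zvec => forall i, (i < d)%nat -> (Z.abs (k i) <= Z.of_nat K)%Z).
  (* Splits [F] pointwise into [F1], whose box sums no longer change beyond [K], and a remainder
     below [c * u]. Boundedness of the increasing partial sums follows. *)
  set (F1 := fun k => if excluded_middle_informative (inside k) then F k else 0).
  assert (Hb : forall N, (K <= N)%nat -> s N <= s K + c * T).
  { intros N HN; unfold s.
    apply Rle_trans with (lsum (fun k => F1 k + c * u k) (box d N)).
    - apply lsum_le; intros k; unfold F1; specialize (Hu k).
      destruct excluded_middle_informative as [|Hn]; [nra|].
      rewrite Rplus_0_l; apply Hout; apply NNPP; intros Hne; apply Hn; intros i Hi.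
      apply Z.nlt_ge; intros Hlt; apply Hne; eauto.
    - rewrite lsum_plus, lsum_scal; apply Rplus_le_compat.
      + rewrite (lsum_box_stable d K N F1 HN).
        * apply lsum_le; intros k; unfold F1; specialize (HF k).
          destruct excluded_middle_informative; lra.
        * intros k; unfold F1; destruct excluded_middle_informative as [Hin|]; [auto|lra].
      + now apply Rmult_le_compat_l. }
  assert (Hmono : forall N, s N <= s K + c * T).
  { intros N; apply Rle_trans with (s (N + K)%nat); [|apply Hb; lia].
    apply Rge_le, growing_prop; [assumption|lia]. }
  destruct (growing_cv s Hgrow) as (S & HS).
  { exists (s K + c * T); intros y (N & ->); apply Hmono. }
  exists S; split; [exact HS|]; fold (s K); split.
  - pose proof (growing_ineq s S Hgrow HS K); lra.
  - enough (S <= s K + c * T) by lra.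
    apply (@Rle_cv_lim s (fun _ => s K + c * T)); [assumption|assumption|].
    intros e He; exists 0%nat; intros; rewrite R_dist_eq; assumption.
Qed.

(** * Passage to the limit in the lattice sum *)

Lemma lsum_limit {A : Type} (conv : R -> A -> R) (w : A -> R) (l : list A) :
  (forall x e, 0 < e -> exists delta, 0 < delta /\
     forall eps, 0 < eps < delta -> Rabs (conv eps x - w x) <= e) ->
  forall e, 0 < e -> exists delta, 0 < delta /\
     forall eps, 0 < eps < delta -> Rabs (lsum (conv eps) l - lsum w l) <= e.
Proof.
  intros Hx; induction l as [|x l IH]; intros e He.
  - exists 1; split; [lra|]; intros; simpl; rewrite Rminus_diag, Rabs_R0; lra.
  - destruct (IH (e / 2) ltac:(lra)) as (d1 & Hd1 & H1).
    destruct (Hx x (e / 2) ltac:(lra)) as (d2 & Hd2 & H2).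
    exists (Rmin d1 d2); split; [now apply Rmin_glb_lt|]; intros eps Heps.
    pose proof (Rmin_l d1 d2); pose proof (Rmin_r d1 d2); simpl.
    specialize (H1 eps ltac:(lra)); specialize (H2 eps ltac:(lra)).
    replace (conv eps x + lsum (conv eps) l - (w x + lsum w l))
      with ((conv eps x - w x) + (lsum (conv eps) l - lsum w l)) by ring.
    eapply Rle_trans; [apply Rabs_triang|lra].
Qed.

Theorem theorem4p2 (d : nat) (H : list (vec * R)) :
  full_dim_polytope d H ->
  exists A : R,
    (* A = A_P(1) = sum_{x in Z^d} omega_P(x) *)
    (exists omega : zvec -> R,
        (forall x : zvec, is_solid_angle d H (ofZ x) (omega x)) /\
        is_lattice_sum d omega A) /\
    (* A = lim_{eps -> 0+} sum_{x in Z^d} (1_P * G_eps)(x) *)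
    (forall e, 0 < e -> exists delta, 0 < delta /\ forall eps, 0 < eps < delta ->
       exists conv : zvec -> R,
         (forall x : zvec,
            is_integral d (fun y => indic (in_poly d H) y * gauss d eps (vsub (ofZ x) y))
                        (conv x)) /\
         exists S, is_lattice_sum d conv S /\ Rabs (S - A) < e).
Proof.
  intros HP; pose proof PI_RGT_0 as Hpi.
  pose proof (poly_jordan d H HP) as HJ.
  destruct (jordan_has_int d _ HJ) as (VP & HVP).
  assert (HVP0 : 0 <= VP).
  { apply (has_int_nonneg d) with (2 := HVP); intros; apply indic_range. }
  pose proof HP as [[M HM] _].
  destruct (INR_unbounded M) as (K & HMK).
  assert (HK : forall y, in_poly d H y -> forall i, (i < d)%nat -> Rabs (y i) <= INR K).
  { intros y Hy i Hi; specialize (HM y Hy i Hi); lra. }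
  destruct (exp_excess_sum K) as (T & HT).
  set (u := fun k : zvec => prod_lt d (fun i => exp (- excess K (k i)))).
  assert (Hu : forall k, 0 <= u k).
  { intros k; apply (prod_lt_le d (fun i => exp (- excess K (k i))) (fun i => exp (- excess K (k i)))).
    intros; split; [apply Rlt_le, exp_pos|lra]. }
  (* The weight is a product over coordinates, so its box sum is the [d]-th power of a
     one-dimensional sum bounded by [T]. *)
  assert (HuT : forall N, lsum u (box d N) <= T ^ d).
  { intros N; eapply Rle_trans; [right; exact (lsum_box_prod d N (fun j => exp (- excess K j)))|].
    apply pow_incr; split; [apply lsum_nonneg; intros; apply Rlt_le, exp_pos|apply HT]. }
  assert (HTd : 0 <= T ^ d) by (eapply Rle_trans; [|apply (HuT 0%nat)]; now apply lsum_nonneg).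
  destruct (exp_decay d PI Hpi) as (D & HD & Hdec).
  assert (HB0 : 0 <= VP * exp 1 * D).
  { repeat apply Rmult_le_pos; try assumption; apply Rlt_le, exp_pos. }
  set (raw := fun eps (k : zvec) =>
    integral d (fun y => indic (in_poly d H) y * bump d (PI / eps) (ofZ k) y)).
  set (conv := fun eps (k : zvec) => raw eps k / sqrt eps ^ d).
  assert (Hraw : forall eps k, 0 < eps ->
    has_int d (fun y => indic (in_poly d H) y * bump d (PI / eps) (ofZ k) y) (raw eps k)).
  { intros eps k He; apply jordan_integral, jordan_mult_lipschitz; [assumption|].
    apply bump_unit_lipschitz, Rdiv_lt_0_compat; assumption. }
  assert (Hsd : forall eps, 0 < eps -> 0 < / sqrt eps ^ d).
  { intros; now apply Rinv_0_lt_compat, pow_lt, sqrt_lt_R0. }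
  assert (Hconv0 : forall eps k, 0 < eps -> 0 <= conv eps k).
  { intros eps k He; apply Rmult_le_pos; [|now apply Rlt_le, Hsd].
    apply (has_int_nonneg d) with (2 := Hraw eps k He); intros y.
    apply Rmult_le_pos; [apply indic_range|apply Rlt_le, exp_pos]. }
  assert (Htail : forall eps k, 0 < eps <= 1 ->
    (exists i, (i < d)%nat /\ (Z.of_nat K < Z.abs (k i))%Z) ->
    conv eps k <= VP * exp 1 * D * eps * u k).
  { intros eps k He Hk; unfold conv.
    apply Rle_trans with (VP * exp (1 - PI / eps) * u k / sqrt eps ^ d).
    - apply Rmult_le_compat_r; [apply Rlt_le, Hsd; lra|].
      apply (conv_tail d H K VP eps k); auto; apply Hraw; lra.
    (* Pulling out [exp 1] leaves [exp (- (PI / eps)) / sqrt eps ^ d], which [exp_decay] with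
       [alpha = PI] bounds by [D * eps], normalisation included. *)
    - unfold Rminus; rewrite exp_plus.
      replace (VP * (exp 1 * exp (- (PI / eps))) * u k / sqrt eps ^ d)
        with (VP * exp 1 * u k * (exp (- (PI / eps)) / sqrt eps ^ d)) by (unfold Rdiv; ring).
      replace (VP * exp 1 * D * eps * u k) with (VP * exp 1 * u k * (D * eps)) by ring.
      apply Rmult_le_compat_l; [|now apply Hdec].
      repeat apply Rmult_le_pos; try assumption; [apply Rlt_le, exp_pos|apply Hu]. }
  destruct (ClassicalEpsilon.choice _ (fun k : zvec => conv_pointwise d H (ofZ k) HP))
    as (omega & Homega).
  assert (Hlim : forall k e, 0 < e -> exists delta, 0 < delta /\
    forall eps, 0 < eps < delta -> Rabs (conv eps k - omega k) <= e).
  { intros k e He; destruct (Homega k) as [_ Hk]; destruct (Hk e He) as (de & Hde & Hd).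
    exists de; split; [assumption|]; intros eps Heps; apply Hd; [assumption|].
    apply Hraw; lra. }
  (* Outside the box [conv eps k] is of order [eps] and tends to [omega k], so the limit is 0. A
     single small [eps] exhibits this up to [e]. *)
  assert (Hzero : forall k, (exists i, (i < d)%nat /\ (Z.of_nat K < Z.abs (k i))%Z) -> omega k = 0).
  { intros k Hk; apply cond_eq; intros e He; rewrite Rminus_0_r.
    set (B := VP * exp 1 * D * u k).
    assert (HB : 0 <= B) by (apply Rmult_le_pos; [assumption|apply Hu]).
    destruct (Hlim k (e / 4) ltac:(lra)) as (de & Hde & Hd).
    set (eps := Rmin (de / 2) (Rmin 1 (e / (4 * (B + 1))))).
    assert (Hq : 0 < e / (4 * (B + 1))) by (apply Rdiv_lt_0_compat; lra).
    assert (H1 : 0 < eps) by (repeat apply Rmin_glb_lt; lra).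
    assert (H2 : eps <= de / 2) by apply Rmin_l.
    assert (H3 : eps <= 1) by (eapply Rle_trans; [apply Rmin_r|apply Rmin_l]).
    assert (H4 : eps <= e / (4 * (B + 1))) by (eapply Rle_trans; [apply Rmin_r|apply Rmin_r]).
    apply Rle_div_r in H4; [|lra].
    specialize (Hd eps ltac:(lra)); specialize (Htail eps k ltac:(lra) Hk).
    specialize (Hconv0 eps k H1).
    replace (VP * exp 1 * D * eps * u k) with (B * eps) in Htail by (unfold B; ring).
    apply Rabs_le_between in Hd; apply Rabs_def1; nra. }
  exists (lsum omega (box d K)); split.
  { exists omega; split; [intros x; apply Homega|].
    intros e He; exists K; intros N HN.
    rewrite (lsum_box_stable d K N); [rewrite R_dist_eq; assumption|lia|].
    intros k Hk i Hi; apply Z.nlt_ge; intros Hlt; apply Hk, Hzero; eauto. }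
  intros e He.
  destruct (lsum_limit conv omega (box d K) Hlim (e / 4) ltac:(lra)) as (d1 & Hd1 & Hsum).
  set (B := VP * exp 1 * D * T ^ d).
  assert (HB : 0 <= B) by (apply Rmult_le_pos; assumption).
  assert (Hq : 0 < e / (4 * (B + 1))) by (apply Rdiv_lt_0_compat; lra).
  (* The finite box contributes an error of at most [e / 4] by [d1], and the tail at most
     [B * eps < e / 4] by the last bound. *)
  exists (Rmin d1 (Rmin 1 (e / (4 * (B + 1))))); split.
  { repeat apply Rmin_glb_lt; lra. }
  intros eps [Heps Hlt].
  apply Rmin_Rgt_l in Hlt as [Hlt1 Hlt]; apply Rmin_Rgt_l in Hlt as [Hlt2 Hlt3].
  apply Rlt_div_r in Hlt3; [|lra].
  exists (conv eps); split.
  - intros x.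
    destruct (jordan_supported d _ HJ) as (M' & HM').
    apply supported_has_int_is_integral with M'.
    + intros y Hy; apply HM'; intros E; apply Hy; rewrite E; ring.
    + apply (has_int_ext d (fun y => / sqrt eps ^ d
        * (indic (in_poly d H) y * bump d (PI / eps) (ofZ x) y))).
      * intros y; rewrite gauss_bump by assumption; ring.
      * unfold conv, Rdiv; rewrite (Rmult_comm (raw eps x)); apply has_int_scal, Hraw, Heps.
  - destruct (lattice_sum_tail d K (conv eps) u (VP * exp 1 * D * eps) (T ^ d))
      as (S & HS & HS1).
    + apply Rmult_le_pos; lra.
    + intros; now apply Hconv0.
    + apply Hu.
    + intros; apply Htail; [lra|assumption].
    + apply HuT.
    + exists S; split; [exact HS|].
      specialize (Hsum eps ltac:(lra)); apply Rabs_le_between in Hsum.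
      replace (VP * exp 1 * D * eps * T ^ d) with (B * eps) in HS1 by (unfold B; ring).
      apply Rabs_def1; nra.
Qed.
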